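(* Let $I$ be a finite index set with at least two elements and let $t_i:\mathbb{R}^n\to[0,\infty)$, $i\in I$, be factors that are log-concave, uniformly bounded, and have support of positive Lebesgue measure. Suppose that at iteration $k$ of the expectation propagation (EP) algorithm for $p(x)\propto\prod_{i\in I}t_i(x)$ the covariances $C_i\in\mathbb{R}^{n\times n}$ of the Gaussian factor approximations $\tilde t_i\propto N(\cdot;\mu_i,C_i)$, $i\in I$, are (symmetric) positive definite. Then the EP updates at step $k+1$ are positive semidefinite; that is, for each $i\in I$, letting $C_{\setminus i}$ denote the covariance of the cavity distribution $\tilde t_{\setminus i}\propto\prod_{j\ne i}\tilde t_j$ formed from the approximations at iteration $k$, and letting $C$ denote the covariance of the probability density proportional to $t_i\,\tilde t_{\setminus i}$, the inverse covariance $C^{-1}-C_{\setminus i}^{-1}$ of the updated factor approximation of $t_i$ is well defined and positive semidefinite.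
   Context: $N(x;\mu,C)=(2\pi)^{-n/2}(\det C)^{-1/2}e^{-\frac12(x-\mu)^tC^{-1}(x-\mu)}$ is the Gaussian density on $\mathbb{R}^n$ with mean $\mu$ and covariance $C$. A nonnegative function $f$ on a real convex vector space $V$ is log-concave if $f(\lambda x_1+(1-\lambda)x_2)\ge f(x_1)^\lambda f(x_2)^{1-\lambda}$ for all $x_1,x_2\in V$ and $\lambda\in[0,1]$. EP algorithm: a target density $p(x)\propto\prod_{i\in I}t_i(x)$ is approximated by $\prod_{i\in I}\tilde t_i(x)$ with Gaussian factors $\tilde t_i$ (up to multiplicative constants). The factor $i$ is updated as follows: let $\tilde q$ be the Gaussian density minimizing the Kullback--Leibler divergence $D_{KL}(q,\tilde q)=\int q\log(q/\tilde q)\,dx$, where $q$ is the probability density proportional to $t_i\prod_{j\neq i}\tilde t_j$; the Gaussian $\tilde q$ is the one having the same mean and covariance as $q$. The new factor approximation is $\tilde t_i:=\tilde q/\prod_{j\ne i}\tilde t_j$, whose inverse covariance (the matrix $K$ in $\tilde t_i(x)\propto e^{-\frac12x^tKx+h^tx}$, which need not be invertible) is (inverse covariance of $\tilde q$) minus (inverse covariance of the cavity distribution $\prod_{j\ne i}\tilde t_j$). *)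

(* Defs.v *)
From HB Require Import structures.
From mathcomp Require Import all_boot all_order all_algebra.
From mathcomp Require Import all_classical all_reals all_analysis.

Set Implicit Arguments.
Unset Strict Implicit.
Unset Printing Implicit Defensive.

Import Order.TTheory GRing.Theory Num.Theory.
Import numFieldNormedType.Exports.

Local Open Scope classical_set_scope.
Local Open Scope ring_scope.

Definition measure_cV_display : measure_display -> measure_display.
Proof. exact. Qed.

Section measurable_cV.
Context d (T : measurableType d) (n : nat).

Let coor (i : 'I_n) (x : 'cV[T]_n) : T := x i ord0.

(* The sigma-algebra generated by the coordinates, as for n.-tuple T. *)
HB.instance Definition _ := @isMeasurable.Build (measure_cV_display d)
  'cV[T]_n (g_sigma_preimage coor) (@sigma_algebra0 _ _ _)
  (@sigma_algebraC _ _) (@sigma_algebra_bigcup _ _ _).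

Lemma measurable_coor i : measurable_fun setT (fun x : 'cV[T]_n => x i ord0).
Proof.
move=> _ Y mY; rewrite setTI; apply: sub_sigma_algebra => /=.
rewrite -bigcup_seq/=; exists i => /=; first by rewrite mem_index_enum.
by exists Y => //; rewrite setTI.
Qed.

Lemma measurable_fun_cVP d' (T' : measurableType d') (f : T' -> 'cV[T]_n) :
  (forall i, measurable_fun setT (fun x => f x i ord0)) -> measurable_fun setT f.
Proof.
move=> mf; have E : @measurable _ 'cV[T]_n = <<s \big[setU/set0]_(i < n)
    preimage_set_system setT (coor i) measurable >> by [].
refine (@measurability _ _ T' 'cV[T]_n setT f _ E _) => _ [B /= + <-].
rewrite -bigcup_seq => -[i _ [A mA <-]]; rewrite !setTI.
by have := mf i measurableT A mA; rewrite setTI.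
Qed.

End measurable_cV.

Section borel_Rn.
Context {R : realType}.

Definition cons_cV n (p : R * 'cV[R]_n) : 'cV[R]_n.+1 := col_mx p.1%:M p.2.

(* n-fold product of the Lebesgue measure on R, on the Borel sets of R^n. *)
Fixpoint borel_Rn n : set 'cV[R]_n -> \bar R :=
  match n with
  | 0 => dirac (0 : 'cV[R]_0)
  | n'.+1 => pushforward (lebesgue_measure \x @borel_Rn n')%E (@cons_cV n')
  end.

Lemma cons_cV0 n (p : R * 'cV[R]_n) : cons_cV p ord0 ord0 = p.1.
Proof.
rewrite /cons_cV (_ : ord0 = lshift n (ord0 : 'I_1)); last exact/val_inj.
by rewrite (@col_mxEu R 1 n 1) mxE eqxx mulr1n.
Qed.

Lemma cons_cVS n (p : R * 'cV[R]_n) i : cons_cV p (lift ord0 i) ord0 = p.2 i ord0.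
Proof.
rewrite /cons_cV (_ : lift ord0 i = rshift 1 i); last exact/val_inj.
by rewrite (@col_mxEd R 1 n 1).
Qed.

Lemma measurable_cons_cV n : measurable_fun setT (@cons_cV n).
Proof.
apply: measurable_fun_cVP => i; case: (unliftP ord0 i) => [j ->|->].
  under eq_fun do rewrite cons_cVS.
  exact: (measurableT_comp (measurable_coor j) measurable_snd).
by under eq_fun do rewrite cons_cV0; exact: measurable_fst.
Qed.

Definition uncons_cV n (x : 'cV[R]_n.+1) : R * 'cV[R]_n :=
  (x ord0 ord0, \col_i x (lift ord0 i) ord0).

Lemma cons_cVK n : cancel (@cons_cV n) (@uncons_cV n).
Proof.
move=> [a x]; rewrite /uncons_cV cons_cV0; congr pair.
by apply/colP => i; rewrite mxE cons_cVS.
Qed.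

Lemma measurable_uncons_cV n : measurable_fun setT (@uncons_cV n).
Proof.
apply: measurable_fun_pair; first exact: measurable_coor.
apply: measurable_fun_cVP => i; under eq_fun do rewrite mxE.
exact: measurable_coor.
Qed.

Lemma borel_Rn_ex n :
  exists m : {sigma_finite_measure set 'cV[R]_n -> \bar R}, @borel_Rn n = m.
Proof.
elim: n => [|n [m mE]] /=.
  by exists (dirac (0 : 'cV[R]_0)).
rewrite mE.
pose mu : {measure set (measurableTypeR R * 'cV[R]_n)%type -> \bar R} :=
  (lebesgue_measure \x m)%E.
have [F FT mF] : sigma_finite setT mu.
  have /sigma_finiteP[F [TF ndF Foo]] := sigma_finiteT (@lebesgue_measure R).
  have /sigma_finiteP[G [TG ndG Goo]] := sigma_finiteT m.
  exists (fun k => F k `*` G k).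
    rewrite -setXTT TF TG predeqE => -[x y]; split; last first.
      by move=> [k _ []/= ? ?]; split; exists k.
    move=> [/= [k _ Fkx] [l _ Gly]]; exists (maxn k l) => //; split.
      by move: x Fkx; exact/subsetPset/ndF/leq_maxl.
    by move: y Gly; exact/subsetPset/ndG/leq_maxr.
  move=> k; have [? ?] := Foo k; have [? ?] := Goo k.
  split; first exact: measurableX.
  by rewrite [ltLHS]product_measure1E// lte_mul_pinfty// ge0_fin_numE.
set m' := pushforward _ _.
have sm' : sigma_finite setT m'.
  exists (fun k => @uncons_cV n @^-1` F k).
    by rewrite -preimage_bigcup -FT preimage_setT.
  move=> k; have [mFk Fkoo] := mF k; split.
    by rewrite -[X in measurable X]setTI; exact: measurable_uncons_cV.
  rewrite /m' /pushforward -comp_preimage.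
  rewrite (_ : _ \o _ = id) ?preimage_id//.
  by apply/funext => p /=; rewrite cons_cVK.
pose mm : {measure set 'cV[R]_n.+1 -> \bar R} :=
  measure_function_pushforward__canonical__measure_function_Measure
    mu (@measurable_cons_cV n).
pose M := Measure_isSigmaFinite.Build _ _ _ mm sm'.
pose mS : {sigma_finite_measure set 'cV[R]_n.+1 -> \bar R} :=
  HB.pack (Measure.sort mm) mm M.
by exists mS.
Qed.

Let borel_Rn_set0 n : @borel_Rn n set0 = 0%E.
Proof. by have [m ->] := borel_Rn_ex n; exact: measure0. Qed.

Let borel_Rn_ge0 n A : (0 <= @borel_Rn n A)%E.
Proof. by have [m ->] := borel_Rn_ex n; exact: measure_ge0. Qed.

Let borel_Rn_semi_sigma_additive n : semi_sigma_additive (@borel_Rn n).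
Proof.
by have [m ->] := borel_Rn_ex n; exact: measure_semi_sigma_additive.
Qed.

HB.instance Definition _ n := isMeasure.Build _ _ _ (@borel_Rn n)
  (@borel_Rn_set0 n) (@borel_Rn_ge0 n) (@borel_Rn_semi_sigma_additive n).

Let borel_Rn_sigma_finite n : sigma_finite setT (@borel_Rn n).
Proof. by have [m ->] := borel_Rn_ex n; exact: sigma_finiteT. Qed.

HB.instance Definition _ n := Measure_isSigmaFinite.Build _ _ _ (@borel_Rn n)
  (@borel_Rn_sigma_finite n).

End borel_Rn.
Arguments borel_Rn {R} n.

(* Lebesgue measure on R^n: the completion of the product measure, defined on
   the Lebesgue-measurable (Caratheodory-measurable) subsets of 'cV[R]_n.
   Completing matters: a log-concave function is Lebesgue measurable but, for
   n >= 2, not always Borel measurable. *)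
Definition lebesgue_Rn {R : realType} n : set _ -> \bar R :=
  @completed_measure_extension _ _ _ (@borel_Rn R n).
Arguments lebesgue_Rn {R} n.
HB.instance Definition _ (R : realType) n := Measure.on (@lebesgue_Rn R n).

Section lebesgue_Rn_box.
Context {R : realType}.

Let box n (a b : 'cV[R]_n) : set 'cV[R]_n :=
  [set x | forall i, a i ord0 <= x i ord0 <= b i ord0].

Let measurable_box n (a b : 'cV[R]_n) : measurable (box a b).
Proof.
have -> : box a b = \bigcap_(i in [set: 'I_n])
    ((fun x : 'cV[R]_n => x i ord0) @^-1` `[a i ord0, b i ord0]).
  apply/seteqP; split => x /= h i; first by move=> _ /=; rewrite in_itv/=.
  by have := h i I; rewrite /= in_itv.
apply: fin_bigcap_measurable => // i _; rewrite -[X in measurable X]setTI.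
by apply: measurable_coor => //; exact: measurable_itv.
Qed.

Lemma lebesgue_Rn_box n (a b : 'cV[R]_n) :
  (forall i, a i ord0 <= b i ord0) ->
  lebesgue_Rn n (box a b) = (\prod_(i < n) (b i ord0 - a i ord0))%:E.
Proof.
move=> ab; rewrite /lebesgue_Rn /completed_measure_extension measurable_mu_extE//.
elim: n a b ab => [|n IHn] a b ab.
  by rewrite big_ord0 /= diracE mem_set// => -[].
pose a' := \col_i a (lift ord0 i) ord0; pose b' := \col_i b (lift ord0 i) ord0.
transitivity ((lebesgue_measure \x borel_Rn n)%E
    (`[a ord0 ord0, b ord0 ord0]%classic `*` box a' b')).
  rewrite /= /pushforward; congr (_ _); apply/seteqP; split => -[u x] /=.
    move=> h; split; first by have := h ord0; rewrite cons_cV0 in_itv.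
    by move=> i; have := h (lift ord0 i); rewrite cons_cVS !mxE.
  move=> [h0 h] i; case: (unliftP ord0 i) => [j ->|->].
    by have := h j; rewrite cons_cVS !mxE.
  by rewrite cons_cV0; move: h0; rewrite in_itv.
rewrite product_measure1E//; last exact: measurable_box.
transitivity (lebesgue_measure `[a ord0 ord0, b ord0 ord0]%classic *
    (\prod_(i < n) (b' i ord0 - a' i ord0))%:E)%E.
  by congr (_ * _)%E; apply: IHn => i; rewrite !mxE.
rewrite lebesgue_measure_itv/= lte_fin.
rewrite big_ord_recl; under eq_bigr do rewrite !mxE.
case: ltP => [_|ba]; first by rewrite -EFinB -EFinM.
have -> : b ord0 ord0 = a ord0 ord0 by apply/eqP; rewrite eq_le ba ab.
by rewrite subrr mul0e mul0r.
Qed.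

End lebesgue_Rn_box.

Section matrices.
Context {R : realType} {n : nat}.
Implicit Types (A : 'M[R]_n) (x : 'cV[R]_n).

Definition qform A x : R := (x^T *m A *m x) ord0 ord0.

Definition posdefmx A := A^T = A /\ forall x, x != 0 -> 0 < qform A x.

Definition possemidefmx A := A^T = A /\ forall x, 0 <= qform A x.

End matrices.

Definition log_concave {R : realType} {V : lmodType R} (f : V -> R) :=
  forall x1 x2 (lambda : R), 0 <= lambda <= 1 ->
    f x1 `^ lambda * f x2 `^ (1 - lambda) <=
      f (lambda *: x1 + (1 - lambda) *: x2).

Section densities.
Context {R : realType} {n : nat}.
Implicit Types f g p : 'cV[R]_n -> R.

Local Notation leb := (@lebesgue_Rn R n).

Definition gauss_pdf (mu : 'cV[R]_n) (C : 'M[R]_n) (x : 'cV[R]_n) : R :=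
  (2 * pi) `^ (- (n%:R / 2)) * (\det C) `^ (- (1 / 2))
    * expR (- (1 / 2) * qform (invmx C) (x - mu)).

Definition proportional f g := exists2 c : R, 0 < c & forall x, f x = c * g x.

Definition mass f : R := \int[leb]_x f x.

Definition normalizable f := leb.-integrable setT (EFin \o f) /\ 0 < mass f.

Definition normalized f : 'cV[R]_n -> R := fun x => f x / mass f.

Definition has_second_moments p :=
  (forall j, leb.-integrable setT (fun x : 'cV[R]_n => (x j ord0 * p x)%:E)) /\
  (forall j k, leb.-integrable setT
     (fun x : 'cV[R]_n => (x j ord0 * x k ord0 * p x)%:E)).

Definition mean p : 'cV[R]_n :=
  \col_j \int[leb]_x ((x : 'cV[R]_n) j ord0 * p x).

Definition covmx p : 'M[R]_n :=
  \matrix_(j, k) \int[leb]_x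
    (((x : 'cV[R]_n) j ord0 - mean p j ord0) *
     ((x : 'cV[R]_n) k ord0 - mean p k ord0) * p x).

(* K is the inverse covariance of a Gaussian factor, which need not be
   integrable: f x is proportional to exp(- x^T K x / 2 + h^T x). *)
Definition has_inverse_covariance f (K : 'M[R]_n) :=
  K^T = K /\ exists h : 'cV[R]_n,
    proportional f
      (fun x => expR (- (1 / 2) * qform K x + (h^T *m x) ord0 ord0)).

End densities.

Section EP.
Context {R : realType} {n : nat} {I : finType}.
Implicit Types (t tapp : I -> 'cV[R]_n -> R) (i : I).

Definition cavity tapp i : 'cV[R]_n -> R := fun x => \prod_(j | j != i) tapp j x.

Definition tilted t tapp i : 'cV[R]_n -> R := fun x => t i x * cavity tapp i x.

(* The Gaussian with the mean and covariance of the tilted density is the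
   Kullback-Leibler projection of that density onto the Gaussians. *)
Definition ep_projection t tapp i : 'cV[R]_n -> R :=
  let q := normalized (tilted t tapp i) in gauss_pdf (mean q) (covmx q).

Definition ep_update t tapp i : 'cV[R]_n -> R :=
  fun x => ep_projection t tapp i x / cavity tapp i x.

End EP.

(* Main.v *)
Require Import Defs.
From HB Require Import structures.
From mathcomp Require Import all_boot all_order all_algebra.
From mathcomp Require Import all_classical all_reals all_analysis.
From mathcomp Require Import measurable_realfun ring lra.

Set Implicit Arguments.
Unset Strict Implicit.
Unset Printing Implicit Defensive.

Import Order.TTheory GRing.Theory Num.Theory.
Import numFieldNormedType.Exports.

Local Open Scope classical_set_scope.
Local Open Scope ring_scope.

(** Fix the index [i] and put [A = \sum_(j != i) C_j^-1].  The cavity is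
proportional to a Gaussian weight [g x = exp (- x^T A x / 2 + h^T x)], whose
covariance is [A^-1], and the update of [t_i] is, up to a constant, the quotient
of the Gaussian with the moments of [t_i g] by [g].  Its inverse covariance is
therefore [C^-1 - A], where [C] is the covariance of [t_i g].  Inversion reverses
the order of positive definite matrices ([posdef_invmx_anti]), so that everything
rests on the inequality [C <= A^-1]: multiplying a Gaussian by a log-concave
function does not increase the variance in any direction.

This inequality is read off from moment generating functions.  For a direction
[u] put [v = A^-1 u].  Completing the square, [exp (s u^T x) g x] is
[exp (kappa s) g (x - s v)] with [kappa s + kappa (- s) = s^2 u^T A^-1 u], hence
the moment generating function of [t g] along [u] is [exp (kappa s) J (s v)],
where [J v] is the integral of [t x * g (x - v)] ([tilt_mgf]).  The
Prekopa-Leindler inequality at midpoints gives [J v * J (- v) <= J 0 ^ 2]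
([shifted_mass_log_concave]), so the product of the values at [s] and [- s] of
the normalized moment generating function is at most
[exp (s^2 u^T A^-1 u)].  For a centered variable of variance [V] this product is
[1 + s^2 V + O(s^3)], and comparing the terms of second order gives
[V <= u^T A^-1 u] ([covmx_tilt_le]).  When [t] is constant, [J] is constant by
translation invariance and the same argument gives an equality; that is how the
covariance of the cavity is computed ([covmx_gauss_weight]).

The Prekopa-Leindler inequality is proved on the line, from the Brunn-Minkowski
inequality for superlevel sets and the layer cake formula, and then in every
dimension by integrating one coordinate at a time.  The induction uses Tonelli's
theorem and thus concerns Borel functions, while a log-concave function is only
Lebesgue measurable.  Its superlevel sets are convex, however, and the boundary
of a convex set is a null set ([convex_boundary_null]); their interiors and
closures produce Borel functions below and above [t] that agree with [t] off a
null set ([log_concave_borel_sandwich]), which is all that integrals can see.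

The nondegeneracy of [C] comes from the nullity of hyperplanes ([posdef_covmx]),
and all integrability from the bound of [g] by a multiple of an isotropic Gaussian
([gauss_weight_le]). *)

(** * Quadratic forms *)

Section quadratic_forms.
Context {R : realType} {n : nat}.
Implicit Types (A B : 'M[R]_n) (u x y : 'cV[R]_n).

Definition dot u x : R := (u^T *m x) ord0 ord0.

Lemma dotE u x : dot u x = \sum_i u i ord0 * x i ord0.
Proof. by rewrite /dot mxE; apply: eq_bigr => i _; rewrite mxE. Qed.

Lemma dotC u x : dot u x = dot x u.
Proof. by rewrite !dotE; apply: eq_bigr => i _; rewrite mulrC. Qed.

Lemma dotDr u x y : dot u (x + y) = dot u x + dot u y.
Proof. by rewrite /dot mulmxDr mxE. Qed.

Lemma dotNr u x : dot u (- x) = - dot u x.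
Proof. by rewrite /dot mulmxN mxE. Qed.

Lemma dotZr u a x : dot u (a *: x) = a * dot u x.
Proof. by rewrite /dot -scalemxAr mxE. Qed.

Lemma dotBr u x y : dot u (x - y) = dot u x - dot u y.
Proof. by rewrite dotDr dotNr. Qed.

Lemma dotDl u x y : dot (x + y) u = dot x u + dot y u.
Proof. by rewrite !(dotC _ u) dotDr. Qed.

Lemma dotZl u a x : dot (a *: x) u = a * dot x u.
Proof. by rewrite !(dotC _ u) dotZr. Qed.

Lemma dotNl u x : dot (- x) u = - dot x u.
Proof. by rewrite !(dotC _ u) dotNr. Qed.

Lemma dot0r u : dot u 0 = 0.
Proof. by rewrite /dot mulmx0 mxE. Qed.

Lemma dot_suml (I : finType) (P : pred I) (F : I -> 'cV[R]_n) x :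
  dot (\sum_(i | P i) F i) x = \sum_(i | P i) dot (F i) x.
Proof. by apply: (big_morph (dot^~ x)) => [? ?|]; rewrite ?dotDl// dotC dot0r. Qed.

Lemma dot_mulmxl A u x : dot (A *m u) x = dot u (A^T *m x).
Proof. by rewrite /dot trmx_mul mulmxA. Qed.

Lemma dot_delta i x : dot (delta_mx i ord0) x = x i ord0.
Proof.
rewrite dotE (bigD1 i)//= big1 ?addr0 => [|j ji]; rewrite !mxE !eqxx ?mul1r//.
by rewrite (negbTE ji) mul0r.
Qed.

Lemma qformE A x : qform A x = dot x (A *m x).
Proof. by rewrite /qform /dot mulmxA. Qed.

Lemma qformD A x y : A^T = A ->
  qform A (x + y) = qform A x + 2 * dot x (A *m y) + qform A y.
Proof.
move=> As; rewrite !qformE mulmxDr !dotDr !dotDl.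
have -> : dot y (A *m x) = dot x (A *m y) by rewrite dotC dot_mulmxl As.
ring.
Qed.

Lemma qformZ A a x : qform A (a *: x) = a ^+ 2 * qform A x.
Proof. by rewrite !qformE -scalemxAr dotZr dotZl mulrA expr2. Qed.

Lemma qformN A x : qform A (- x) = qform A x.
Proof. by rewrite -scaleN1r qformZ sqrrN expr1n mul1r. Qed.

Lemma qformB A x y : A^T = A ->
  qform A (x - y) = qform A x - 2 * dot x (A *m y) + qform A y.
Proof. by move=> As; rewrite qformD// mulmxN dotNr qformN mulrN. Qed.

Lemma qform0 A : qform A 0 = 0.
Proof. by rewrite qformE mulmx0 dot0r. Qed.

Lemma qform_addl A B x : qform (A + B) x = qform A x + qform B x.
Proof. by rewrite !qformE mulmxDl dotDr. Qed.

Lemma qform_suml (I : finType) (P : pred I) (F : I -> 'M[R]_n) x :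
  qform (\sum_(i | P i) F i) x = \sum_(i | P i) qform (F i) x.
Proof.
apply: (big_morph (qform^~ x)) => [? ?|]; first exact: qform_addl.
by rewrite qformE mul0mx dot0r.
Qed.

Lemma qform_subl A B x : qform (A - B) x = qform A x - qform B x.
Proof. by rewrite !qformE mulmxBl dotBr. Qed.

(** Polarization. *)
Lemma sym_qform_inj A B : A^T = A -> B^T = B ->
  (forall x, qform A x = qform B x) -> A = B.
Proof.
move=> As Bs AB.
have key x y : dot x (A *m y) = dot x (B *m y).
  by have := AB (x + y); rewrite !qformD// !AB; lra.
apply/matrixP => i j; have := key (delta_mx i ord0) (delta_mx j ord0).
by rewrite !dot_delta -!colE !mxE.
Qed.

Lemma posdef_ge0 A x : posdefmx A -> 0 <= qform A x.
Proof.
move=> [_ pA]; have [->|/pA/ltW//] := eqVneq x 0.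
by rewrite qform0.
Qed.

Lemma posdef_unitmx A : posdefmx A -> A \in unitmx.
Proof.
move=> [As pA]; rewrite -row_free_unit -kermx_eq0.
apply/eqP/row_matrixP => i; rewrite row0; apply/eqP/negPn/negP => k0.
have := pA (row i (kermx A))^T; rewrite trmx_eq0 qformE => /(_ k0).
have kA : row i (kermx A) *m A = 0 by apply/sub_kermxP; exact: row_sub.
have -> : A *m (row i (kermx A))^T = 0.
  by apply: trmx_inj; rewrite trmx_mul trmxK As trmx0.
by rewrite dot0r ltxx.
Qed.

Lemma sym_invmx A : A^T = A -> (invmx A)^T = invmx A.
Proof. by move=> As; rewrite trmx_inv As. Qed.

Lemma qform_invmx A u : A^T = A -> A \in unitmx ->
  qform (invmx A) u = qform A (invmx A *m u).
Proof. by move=> As Au; rewrite !qformE mulKVmx// dotC. Qed.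

Lemma posdef_invmx A : posdefmx A -> posdefmx (invmx A).
Proof.
move=> pA; have Au := posdef_unitmx pA; case: (pA) => As pAx.
split=> [|x x0]; first exact: sym_invmx.
rewrite qform_invmx//; apply: pAx; apply: contra_neq x0 => Ax0.
by rewrite -(mulKVmx Au x) Ax0 mulmx0.
Qed.

Lemma posdef_sum (I : finType) (P : pred I) (F : I -> 'M[R]_n) :
  (exists i, P i) -> (forall i, P i -> posdefmx (F i)) ->
  posdefmx (\sum_(i | P i) F i).
Proof.
move=> [i0 Pi0] pF; split.
  by rewrite linear_sum; apply: eq_bigr => i /pF[].
move=> x x0; rewrite qform_suml (bigD1 i0)//=.
apply: ltr_wpDr; last exact: (pF _ Pi0).2.
by apply: sumr_ge0 => i /andP[Pi _]; exact/posdef_ge0/pF.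
Qed.

(** Expand [0 <= Q (x - A^-1 u)], where [Q] is the form of [A]. *)
Lemma posdef_young A u x : posdefmx A ->
  2 * dot u x <= qform A x + qform (invmx A) u.
Proof.
move=> pA; have Au := posdef_unitmx pA; case: (pA) => As _.
have := posdef_ge0 (x - invmx A *m u) pA.
by rewrite qformB// mulKVmx// -qform_invmx// dotC; lra.
Qed.

(** Cauchy-Schwarz for the scalar product of [A], against the vector
[A^-1 e_i]. *)
Lemma posdef_coord_le A i x : posdefmx A ->
  x i ord0 ^+ 2 <= invmx A i i * qform A x.
Proof.
move=> pA; have pA' := posdef_invmx pA.
have E : qform (invmx A) (delta_mx i ord0) = invmx A i i.
  by rewrite qformE dot_delta -colE mxE.
have K0 : 0 < invmx A i i.
  rewrite -E; apply: pA'.2; apply/eqP => /matrixP/(_ i ord0)/eqP.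
  by rewrite !mxE !eqxx oner_eq0.
have := posdef_young ((x i ord0 / invmx A i i) *: delta_mx i ord0) x pA.
rewrite dotZl qformZ E dot_delta expr_div_n.
move: (invmx A i i) K0 (x i ord0) => k K0 a h.
rewrite mulrC -ler_pdivrMr//.
have E1 : a / k * a = a ^+ 2 / k by field; lra.
have E2 : a ^+ 2 / k ^+ 2 * k = a ^+ 2 / k by field; lra.
move: h; rewrite E1 E2; lra.
Qed.

(** The form of [A^-1] is the Legendre transform of that of [A], and the Legendre
transform reverses the order. *)
Lemma posdef_invmx_anti A B : posdefmx A -> posdefmx B ->
  (forall x, qform A x <= qform B x) ->
  forall u, qform (invmx B) u <= qform (invmx A) u.
Proof.
move=> pA pB AB u; have Bu := posdef_unitmx pB; case: (pB) => Bs _.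
have := posdef_young u (invmx B *m u) pA; have := AB (invmx B *m u).
by rewrite -qform_invmx// -qformE; lra.
Qed.

End quadratic_forms.

(** * Second moments from exponential moments *)

Section exponential_moments.
Context {R : realType}.

(** The remainder of the exponential series is dominated, term by term, by
[|y|^3] times the series of [exp |y|]. *)
Lemma expR_taylor2 (y : R) :
  `|expR y - (1 + y + y ^+ 2 / 2)| <= `|y| ^+ 3 * expR `|y|.
Proof.
have cy := is_cvg_series_exp_coeff y; have cay := is_cvg_series_exp_coeff `|y|.
have nd : nondecreasing_seq (series (exp_coeff `|y|)).
  by apply: nondecreasing_series => i _ _; exact: exp_coeff_ge0.
have E N : series (exp_coeff y) (N + 3)%N - (1 + y + y ^+ 2 / 2) =
    \sum_(0 <= k < N) exp_coeff y (k + 3)%N.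
  rewrite /series /= addnC big_mkord big_split_ord /= !big_ord_recl big_ord0.
  rewrite /exp_coeff /= big_mkord.
  under eq_bigr do rewrite addnC.
  by rewrite !fact0 expr0 expr1 divr1 /bump /= /factorial /=; field.
have c3 : (fun N => series (exp_coeff y) (N + 3)%N - (1 + y + y ^+ 2 / 2))
    @ \oo --> expR y - (1 + y + y ^+ 2 / 2).
  apply: cvgB; last exact: cvg_cst.
  by rewrite (cvg_shiftn 3 (series (exp_coeff y))).
apply: (cvgr_to_le (cvg_norm c3)) => //.
apply: nearW => N; rewrite E.
apply: (le_trans (ler_norm_sum _ _ _)).
apply: (@le_trans _ _ (`|y| ^+ 3 * series (exp_coeff `|y|) N)); last first.
  by rewrite ler_wpM2l ?exprn_ge0// nondecreasing_cvgn_le.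
rewrite /series /= mulr_sumr; apply: ler_sum => k _.
rewrite /exp_coeff /= normrM normrX normfV normr_nat exprD.
rewrite [leRHS]mulrA (mulrC (`|y| ^+ 3)) ler_wpM2l ?mulr_ge0 ?exprn_ge0//.
by rewrite lef_pV2 ?posrE ?ltr0n ?fact_gt0// ler_nat leq_fact// leq_addr.
Qed.

Lemma le0_of_le_small (x M : R) :
  (forall s, 0 < s <= 1 -> x <= s * M) -> x <= 0.
Proof.
move=> h; rewrite leNgt; apply/negP => x0.
have M0 : 0 < M by have := h 1; rewrite mul1r ltr01 lexx => /(_ isT); lra.
have s0 : 0 < x / (x + M) by rewrite divr_gt0 ?addr_gt0.
have := h (x / (x + M)).
rewrite s0 ler_pdivrMr ?addr_gt0// mul1r lerDl ltW// => /(_ isT).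
rewrite mulrAC ler_pdivlMr ?addr_gt0// ler_pM2l//; lra.
Qed.

(** The second order coefficients of both sides at [s = 0] can be compared,
up to an error of order [s ^ 3]. *)
Lemma second_order_le (V K c : R) (a b : R -> R) : 0 <= V -> 0 <= K ->
  (forall s, 0 <= a s) -> (forall s, 0 <= b s) ->
  (forall s, 0 < s <= 1 -> 1 + s ^+ 2 * V / 2 - s ^+ 3 * K <= a s) ->
  (forall s, 0 < s <= 1 -> 1 + s ^+ 2 * V / 2 - s ^+ 3 * K <= b s) ->
  (forall s, a s * b s <= expR (c * s ^+ 2)) -> V <= c.
Proof.
move=> V0 K0 a0 b0 Va Vb abc; rewrite -subr_le0.
pose D := c ^+ 2 / 2 + `|c| ^+ 3 * expR `|c|.
have D0 : 0 <= D.
  by apply: addr_ge0; apply: mulr_ge0; rewrite ?sqr_ge0 ?expR_ge0 ?exprn_ge0 ?invr_ge0.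
apply: (@le0_of_le_small _ (2 * K + V * K + D)) => s s01.
have /andP[s0 s1] := s01; have s0' := ltW s0.
have e : expR (c * s ^+ 2) <= 1 + c * s ^+ 2 + s ^+ 4 * D.
  have := expR_taylor2 (c * s ^+ 2); rewrite ler_norml => /andP[_].
  rewrite normrM [`|s ^+ 2|]ger0_norm ?sqr_ge0//.
  have ss : s ^+ 2 <= 1 by rewrite exprn_ile1// ltW.
  have : (`|c| * s ^+ 2) ^+ 3 * expR (`|c| * s ^+ 2) <=
      s ^+ 4 * (`|c| ^+ 3 * expR `|c|).
    rewrite exprMn [leRHS]mulrA ler_pM ?mulr_ge0 ?exprn_ge0 ?expR_ge0 ?sqr_ge0//.
      rewrite mulrC ler_wpM2r ?exprn_ge0// -exprM.
      by rewrite (_ : 2 * 3 = 4 + 2)%N// exprD ler_piMr// exprn_ge0// ltW.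
    by rewrite ler_expR ler_piMr.
  rewrite /D [(c * _) ^+ 2]exprMn (_ : s ^+ 2 ^+ 2 = s ^+ 4); last by rewrite -exprM.
  move: (expR (c * _)) (_ * expR (`|c| * _)) => x y; lra.
have B0 : 0 <= s ^+ 3 * K by apply: mulr_ge0 => //; exact: exprn_ge0.
have A0 : 0 <= s ^+ 2 * V / 2.
  by apply: divr_ge0 => //; apply: mulr_ge0 => //; exact: sqr_ge0.
have key : 1 + s ^+ 2 * V - s ^+ 3 * (2 * K + V * K) <= a s * b s.
  have := Va s s01; have := Vb s s01; have := a0 s; have := b0 s.
  move: (a s) (b s) => x y {a b Va Vb abc a0 b0 e D D0} y0 x0 hy hx.
  have VK : 0 <= s ^+ 3 * (V * K) by apply: mulr_ge0; [exact: exprn_ge0|exact: mulr_ge0].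
  have E : 1 + s ^+ 2 * V - s ^+ 3 * (2 * K + V * K) =
    1 + 2 * (s ^+ 2 * V / 2) - 2 * (s ^+ 3 * K) - s ^+ 3 * (V * K) by field.
  rewrite E; have [B|B] := lerP (s ^+ 3 * K) (1 + s ^+ 2 * V / 2); last first.
    by apply: (@le_trans _ _ 0); [lra|exact: mulr_ge0].
  have P : (1 + s ^+ 2 * V / 2 - s ^+ 3 * K) ^+ 2 <= x * y.
    rewrite expr2; apply: ler_pM => //; lra.
  apply: le_trans P.
  have -> : (1 + s ^+ 2 * V / 2 - s ^+ 3 * K) ^+ 2 =
    1 + 2 * (s ^+ 2 * V / 2) + (s ^+ 2 * V / 2) ^+ 2 - 2 * (s ^+ 3 * K)
    - s ^+ 2 * (s ^+ 3 * (V * K)) + (s ^+ 3 * K) ^+ 2 by field.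
  have s3 : s ^+ 2 * (s ^+ 3 * (V * K)) <= s ^+ 3 * (V * K).
    by apply: ler_piMl => //; exact: exprn_ile1.
  have := sqr_ge0 (s ^+ 2 * V / 2); have := sqr_ge0 (s ^+ 3 * K).
  lra.
have f : s ^+ 2 * (V - c) <= s ^+ 2 * (s * (2 * K + V * K) + s ^+ 2 * D).
  have := le_trans key (le_trans (abc s) e).
  move=> {abc key e a b Va Vb a0 b0} h.
  have -> : s ^+ 2 * (s * (2 * K + V * K) + s ^+ 2 * D) =
    s ^+ 3 * (2 * K + V * K) + s ^+ 4 * D by ring.
  lra.
move: f; rewrite ler_pM2l ?exprn_gt0// => /le_trans; apply.
by rewrite [leRHS]mulrDr lerD2l ler_wpM2r// expr2 ler_piMl.
Qed.

(** The bound [1 + y <= exp y] replaces the Taylor expansion here. *)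
Lemma second_order_ge (V K c : R) (a b : R -> R) : 0 <= V -> 0 <= K ->
  (forall s, 0 <= a s) -> (forall s, 0 <= b s) ->
  (forall s, 0 < s <= 1 -> a s <= 1 + s ^+ 2 * V / 2 + s ^+ 3 * K) ->
  (forall s, 0 < s <= 1 -> b s <= 1 + s ^+ 2 * V / 2 + s ^+ 3 * K) ->
  (forall s, expR (c * s ^+ 2) <= a s * b s) -> c <= V.
Proof.
move=> V0 K0 a0 b0 Va Vb abc; rewrite -subr_le0.
apply: (@le0_of_le_small _ (2 * K + (V / 2 + K) ^+ 2)) => s s01.
have /andP[s0 s1] := s01; have s0' := ltW s0.
have key : a s * b s <= (1 + s ^+ 2 * V / 2 + s ^+ 3 * K) ^+ 2.
  by rewrite expr2; apply: ler_pM; [exact: a0|exact: b0|exact: Va|exact: Vb].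
have := le_trans (expR_ge1Dx _) (le_trans (abc s) key).
have -> : (1 + s ^+ 2 * V / 2 + s ^+ 3 * K) ^+ 2 =
    1 + s ^+ 2 * V + s ^+ 2 * (s * (2 * K) + s ^+ 2 * (V / 2 + s * K) ^+ 2).
  by field.
move=> f; have {}f : s ^+ 2 * (c - V) <=
    s ^+ 2 * (s * (2 * K) + s ^+ 2 * (V / 2 + s * K) ^+ 2).
  by move: (s ^+ 2 * (_ + _)) f => x f; lra.
move: f; rewrite ler_pM2l ?exprn_gt0// => /le_trans; apply.
rewrite [leRHS]mulrDr lerD2l; apply: ler_pM; rewrite ?sqr_ge0//.
  by rewrite expr2 ler_piMl.
have sK0 : 0 <= s * K by exact: mulr_ge0.
have V20 : 0 <= V / 2 by rewrite divr_ge0.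
by rewrite lerXn2r ?nnegrE ?addr_ge0// lerD2l ler_piMl.
Qed.

Context d (T : measurableType d) (mu : {measure set T -> \bar R}).
Variables (X p : T -> R).
Hypotheses (mX : measurable_fun setT X) (mp : measurable_fun setT p)
  (p0 : forall x, 0 <= p x).
Hypothesis iexp : forall s : R,
  mu.-integrable setT (fun x => (expR (s * X x) * p x)%:E).

Let a (s : R) := \int[mu]_x (expR (s * X x) * p x).

Lemma pow3_expR (y : R) : `|y| ^+ 3 * expR `|y| <= 6 * (expR (2 * y) + expR (- 2 * y)).
Proof.
have h : `|y| ^+ 3 <= 6 * expR `|y|.
  have := @expR_ge1Dxn R `|y| 2 (normr_ge0 y).
  by rewrite (_ : 3`! = 6)%N//; lra.
apply: (@le_trans _ _ (6 * expR (2 * `|y|))).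
  rewrite [2 * _]mulrDl !mul1r expRD mulrA ler_wpM2r ?expR_ge0//.
rewrite ler_pM2l//; have [y0|y0] := ger0P y.
  by rewrite lerDl expR_ge0.
by rewrite mulrN mulNr lerDr expR_ge0.
Qed.

Lemma integrable_density : mu.-integrable setT (EFin \o p).
Proof.
have := iexp 0; apply: eq_integrable => // x _ /=.
by rewrite mul0r expR0 mul1r.
Qed.

(** [|y|^k <= 2 exp |y| <= 2 (exp y + exp (- y))] for [k <= 2]. *)
Lemma integrable_moment k : (k <= 2)%N ->
  mu.-integrable setT (fun x => (X x ^+ k * p x)%:E).
Proof.
move=> k2; have k0 : (0 : R) <= k`!%:R by rewrite ler0n.
apply: (@le_integrable _ _ _ _ _ _ _
  (fun x => (2%:E * ((expR (1 * X x) * p x)%:E + (expR (-1 * X x) * p x)%:E))%E)) => //.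
- by apply/measurable_EFinP; apply: measurable_funM => //; exact: measurable_funX.
- move=> x _; rewrite lee_fin !normrM normrX.
  rewrite -mulrDl normrM (ger0_norm (p0 x)) mulrA ler_wpM2r// !mul1r mulN1r.
  rewrite (@ger0_norm _ (expR (X x) + _)) ?addr_ge0 ?expR_ge0// normr_nat.
  apply: (@le_trans _ _ (2 * expR `|X x|)).
    have e1 := expR_ge1Dx `|X x|.
    have e2 := @expR_ge1Dxn R `|X x| 1 (normr_ge0 _).
    have n0 := normr_ge0 (X x).
    case: k k2 {k0} => [|[|[|//]]] _; rewrite ?expr0 ?expr1; [lra|lra|].
    by move: e2; rewrite (_ : 2`! = 2)%N//; lra.
  rewrite ler_pM2l//; have [y0|y0] := ger0P (X x).
    by rewrite lerDl expR_ge0.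
  by rewrite lerDr expR_ge0.
- by apply: integrableZl => //; apply: integrableD.
Qed.

Hypotheses (pm : \int[mu]_x p x = 1) (X0 : \int[mu]_x (X x * p x) = 0).
Let V := \int[mu]_x (X x ^+ 2 * p x).
Let K := 6 * (a 2 + a (- 2)).

(** Taylor's formula under the integral sign: the cubic remainder of
[exp (s X)] is dominated by [|s|^3 |X|^3 exp |X|], hence by the exponential
moments of orders [2] and [-2]. *)
Lemma expectation_expR_expansion (s : R) : `|s| <= 1 ->
  `|a s - (1 + s ^+ 2 * V / 2)| <= `|s| ^+ 3 * K.
Proof.
move=> s1.
have i1 : mu.-integrable setT (fun x => (X x * p x)%:E).
  have := integrable_moment (isT : (1 <= 2)%N).
  by apply: eq_integrable => // x _; rewrite expr1.
have i2 := integrable_moment (isT : (2 <= 2)%N).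
have ip := integrable_density.
have is1 : mu.-integrable setT (EFin \o (fun x => s * (X x * p x))).
  by have := integrableZl measurableT s i1.
have is2 : mu.-integrable setT (EFin \o (fun x => s ^+ 2 / 2 * (X x ^+ 2 * p x))).
  by have := integrableZl measurableT (s ^+ 2 / 2) i2.
have ip1 : mu.-integrable setT (EFin \o (fun x => p x + s * (X x * p x))).
  by have := integrableD measurableT ip is1.
have ip2 : mu.-integrable setT
    (EFin \o (fun x => p x + s * (X x * p x) + s ^+ 2 / 2 * (X x ^+ 2 * p x))).
  by have := integrableD measurableT ip1 is2.
have -> : 1 + s ^+ 2 * V / 2 = \int[mu]_x
    (p x + s * (X x * p x) + s ^+ 2 / 2 * (X x ^+ 2 * p x)).
  rewrite RintegralD// RintegralD// !RintegralZl// pm X0 mulr0 addr0.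
  by rewrite mulrAC.
rewrite -RintegralB//; last exact: iexp.
have ib := integrableB measurableT (iexp s) ip2.
apply: (le_trans (le_normr_Rintegral _ _)) => //.
have iK : mu.-integrable setT (EFin \o
    (fun x => `|s| ^+ 3 * 6 * (expR (2 * X x) * p x + expR (- 2 * X x) * p x))).
  have := integrableD measurableT (iexp 2) (iexp (-2)).
  by move=> /(integrableZl measurableT (`|s| ^+ 3 * 6)).
have -> : `|s| ^+ 3 * K = \int[mu]_x
    (`|s| ^+ 3 * 6 * (expR (2 * X x) * p x + expR (- 2 * X x) * p x)).
  rewrite RintegralZl//; last by have := integrableD measurableT (iexp 2) (iexp (-2)).
  rewrite RintegralD//; [|exact: iexp|exact: iexp].
  by rewrite /K mulrA.
apply: le_Rintegral => //.
  by have := integrable_norm ib.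
move=> x _; set y := X x.
have -> : expR (s * y) * p x - (p x + s * (y * p x) + s ^+ 2 / 2 * (y ^+ 2 * p x)) =
    (expR (s * y) - (1 + s * y + (s * y) ^+ 2 / 2)) * p x by field.
rewrite normrM (ger0_norm (p0 x)) -mulrDl mulrA ler_wpM2r//.
apply: (le_trans (expR_taylor2 _)).
rewrite normrM exprMn -2!(mulrA (`|s| ^+ 3)).
rewrite ler_wpM2l ?exprn_ge0//.
apply: (le_trans _ (pow3_expR y)).
rewrite ler_wpM2l ?exprn_ge0// ler_expR ler_piMl//.
Qed.

Let V0 : 0 <= V.
Proof. by apply: Rintegral_ge0 => x _; rewrite mulr_ge0// sqr_ge0. Qed.

Let a0 s : 0 <= a s.
Proof. by apply: Rintegral_ge0 => x _; rewrite mulr_ge0// expR_ge0. Qed.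

Let K0 : 0 <= K. Proof. by rewrite mulr_ge0// addr_ge0. Qed.

Let expansion_bounds s : 0 < s <= 1 ->
  [/\ 1 + s ^+ 2 * V / 2 - s ^+ 3 * K <= a s, a s <= 1 + s ^+ 2 * V / 2 + s ^+ 3 * K,
      1 + s ^+ 2 * V / 2 - s ^+ 3 * K <= a (- s) &
      a (- s) <= 1 + s ^+ 2 * V / 2 + s ^+ 3 * K].
Proof.
move=> /andP[s0 s1].
have := @expectation_expR_expansion s; have := @expectation_expR_expansion (- s).
clearbody a V K; have ns : `|s| = s by rewrite ger0_norm// ltW.
rewrite normrN ns sqrrN s1 => /(_ isT); rewrite ler_distl => /andP[l1 l2].
by move=> /(_ isT); rewrite ler_distl => /andP[l3 l4]; split.
Qed.

Lemma centered_variance_le (c : R) :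
  (forall s, a s * a (- s) <= expR (c * s ^+ 2)) -> V <= c.
Proof.
apply: (second_order_le V0 K0 a0 (fun s => a0 (- s))) => s.
- by move=> /expansion_bounds[/= l _ _ _]; exact: l.
- by move=> /expansion_bounds[/= _ _ l _]; exact: l.
Qed.

Lemma centered_variance_ge (c : R) :
  (forall s, expR (c * s ^+ 2) <= a s * a (- s)) -> c <= V.
Proof.
apply: (second_order_ge V0 K0 a0 (fun s => a0 (- s))) => s.
- by move=> /expansion_bounds[/= _ l _ _]; exact: l.
- by move=> /expansion_bounds[/= _ _ _ l]; exact: l.
Qed.

End exponential_moments.

(** * Integration on R^n *)

Section lebesgue_affine.
Context {R : realType}.
Local Notation mu := (@lebesgue_measure R).
Local Open Scope ereal_scope.

Lemma measurable_affineR (c a : R) :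
  measurable_fun setT ((fun x => c * x + a)%R : measurableTypeR R -> measurableTypeR R).
Proof. by apply: measurable_funD => //; exact: measurable_funM. Qed.

(** A measure on the line is determined by its values on intervals, where the
change of variables is a computation. *)
Lemma lebesgue_integral_affine (c a : R) (f : R -> \bar R) : (0 < c)%R ->
  measurable_fun setT f -> (forall x, 0 <= f x) ->
  \int[mu]_x f (c * x + a)%R = (c^-1)%:E * \int[mu]_x f x.
Proof.
move=> c0 mf f0.
pose phi : measurableTypeR R -> measurableTypeR R := (fun x => c * x + a)%R.
have mphi : measurable_fun setT phi by exact: measurable_affineR.
pose c' := NngNum (ltW c0).
pose nu := mscale c' (measure_function_pushforward__canonical__measure_function_Measure mu mphi).
have E A : measurable A -> mu A = nu A.
  move=> mA; apply: (lebesgue_measure_unique (mu := nu)) => //.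
  move=> _ [[s t]] _ <-.
  suff : mu `]s, t]%classic = c%:E * mu (phi @^-1` `]s, t]%classic) by [].
  have -> : phi @^-1` `]s, t] = `]((s - a) / c)%R, ((t - a) / c)%R]%classic.
    apply/seteqP; split => x /=; rewrite !in_itv/= /phi.
      by rewrite ltr_pdivrMr// ler_pdivlMr// ltrBlDr lerBrDr mulrC.
    by rewrite ltr_pdivrMr// ler_pdivlMr// ltrBlDr lerBrDr mulrC.
  rewrite !lebesgue_measure_itv/= !lte_fin ltr_pM2r ?invr_gt0// ltrD2r.
  case: ifPn => _; last by rewrite mule0.
  by rewrite -EFinM -!EFinB; congr EFin; field; rewrite gt_eqF.
rewrite [in RHS](eq_measure_integral nu) => [|A mA _]; last exact: E.
rewrite [in RHS](ge0_integral_mscale)//=.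
rewrite muleA -EFinM mulVf ?gt_eqF// mul1e.
by rewrite ge0_integral_pushforward.
Qed.

End lebesgue_affine.

Lemma integral_indicT d (T : measurableType d) (R : realType)
    (mu : {measure set T -> \bar R}) (A : set T) : measurable A ->
  (\int[mu]_x (\1_A x : R)%:E)%E = mu A.
Proof. by move=> mA; rewrite integral_indic// setIT. Qed.

Section borel_Rn_integration.
Context {R : realType}.
Local Open Scope ereal_scope.

Lemma ge0_integral_borel_RnS n (f : 'cV[R]_n.+1 -> \bar R) :
  measurable_fun setT f -> (forall x, 0 <= f x) ->
  \int[borel_Rn n.+1]_x f x =
  \int[lebesgue_measure]_a \int[borel_Rn n]_x f (cons_cV (a, x)).
Proof.
move=> mf f0.
pose T : measurableType _ := (measurableTypeR R * 'cV[R]_n)%type.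
pose m : {measure set T -> \bar R} := lebesgue_measure \x borel_Rn n.
have mc : measurable_fun [set: T] (@cons_cV R n) := @measurable_cons_cV R n.
transitivity (\int[m]_p f (cons_cV p)).
  have := ge0_integral_pushforward mc m measurableT mf.
  by rewrite preimage_setT; apply => x _; exact: f0.
have mfc : measurable_fun [set: T] (f \o @cons_cV R n) by exact: measurableT_comp.
exact: (@fubini_tonelli1 _ _ (measurableTypeR R) 'cV[R]_n R
  lebesgue_measure (borel_Rn n) _ mfc (fun=> f0 _)).
Qed.

Lemma measurable_cons_cVr n (f : 'cV[R]_n.+1 -> \bar R) a :
  measurable_fun setT f ->
  measurable_fun setT (fun x : 'cV[R]_n => f (cons_cV (a, x))).
Proof.
move=> mf; apply: (measurableT_comp mf).
by apply: (measurableT_comp (@measurable_cons_cV R n)); exact: measurable_pair1.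
Qed.

Lemma measurable_integral_cons_cV n (f : 'cV[R]_n.+1 -> \bar R) :
  measurable_fun setT f -> (forall x, 0 <= f x) ->
  measurable_fun (setT : set (measurableTypeR R))
    (fun a => \int[borel_Rn n]_x f (cons_cV (a, x))).
Proof.
move=> mf f0.
pose T : measurableType _ := (measurableTypeR R * 'cV[R]_n)%type.
have mc : measurable_fun [set: T] (@cons_cV R n) := @measurable_cons_cV R n.
have mfc : measurable_fun [set: T] (f \o @cons_cV R n) by exact: measurableT_comp.
exact: (@measurable_fun_fubini_tonelli_F _ _ (measurableTypeR R) 'cV[R]_n R
  (borel_Rn n) _ mfc (fun=> f0 _)).
Qed.

Lemma cons_cVZ n c a x : (c *: @cons_cV R n (a, x) = cons_cV (c * a, c *: x))%R.
Proof.
apply/colP => i; rewrite mxE; case: (unliftP ord0 i) => [j ->|->].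
  by rewrite !cons_cVS mxE.
by rewrite !cons_cV0.
Qed.

Lemma cons_cVD n a b x y :
  (@cons_cV R n (a, x) + cons_cV (b, y) = cons_cV (a + b, x + y))%R.
Proof.
apply/colP => i; rewrite mxE; case: (unliftP ord0 i) => [j ->|->].
  by rewrite !cons_cVS mxE.
by rewrite !cons_cV0.
Qed.

Lemma uncons_cVK n : cancel (@uncons_cV R n) (@cons_cV R n).
Proof.
move=> x; apply/colP => i; case: (unliftP ord0 i) => [j ->|->].
  by rewrite cons_cVS mxE.
by rewrite cons_cV0.
Qed.

Lemma dot_cons_cV n a b (x y : 'cV[R]_n) :
  dot (cons_cV (a, x)) (cons_cV (b, y)) = (a * b + dot x y)%R.
Proof.
rewrite !dotE big_ord_recl !cons_cV0; congr (_ + _)%R.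
by apply: eq_bigr => i _; rewrite !cons_cVS.
Qed.

Lemma measurable_affine_cV n (c : R) (a : 'cV[R]_n) :
  measurable_fun setT (fun x : 'cV[R]_n => (c *: x + a)%R).
Proof.
apply: measurable_fun_cVP => i; under eq_fun do rewrite !mxE.
by apply: measurable_funD => //; apply: measurable_funM => //; exact: measurable_coor.
Qed.

Lemma measurable_dot n (u : 'cV[R]_n) : measurable_fun setT (dot u).
Proof.
rewrite (_ : dot u = fun x => (\sum_i u i ord0 * x i ord0)%R); last first.
  by apply/funext => x; exact: dotE.
by apply: measurable_sum => i; apply: measurable_funM => //; exact: measurable_coor.
Qed.

Lemma measurable_qform n (A : 'M[R]_n) : measurable_fun setT (qform A).
Proof.
rewrite (_ : qform A = fun x => (\sum_i x i ord0 * dot (row i A)^T x)%R); last first.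
  apply/funext => x; rewrite qformE dotE; apply: eq_bigr => i _.
  by rewrite /dot trmxK -row_mul [in RHS]mxE.
apply: measurable_sum => i; apply: measurable_funM; last exact: measurable_dot.
exact: measurable_coor.
Qed.

(** One coordinate at a time, each contributing a factor [c^-1]. *)
Lemma integral_borel_Rn_affine n (c : R) (a : 'cV[R]_n) (f : 'cV[R]_n -> \bar R) :
  (0 < c)%R -> measurable_fun setT f -> (forall x, 0 <= f x) ->
  \int[borel_Rn n]_x f (c *: x + a)%R = (c ^- n)%:E * \int[borel_Rn n]_x f x.
Proof.
move=> c0; elim: n a f => [|n IH] a f mf f0.
  rewrite expr0 invr1 mul1e; apply: eq_integral => x _; congr f.
  by apply/colP => -[].
have ci0 : 0 <= (c ^- n)%:E by rewrite lee_fin invr_ge0 exprn_ge0// ltW.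
pose a1 := (uncons_cV a).1; pose a2 := (uncons_cV a).2.
have mfa : measurable_fun setT (fun x : 'cV[R]_n.+1 => f (c *: x + a)%R).
  by apply: (measurableT_comp mf); exact: measurable_affine_cV.
rewrite (ge0_integral_borel_RnS mfa (fun x => f0 _)) (ge0_integral_borel_RnS mf f0).
have := measurable_integral_cons_cV mf f0.
set G := fun b => \int[borel_Rn n]_x f (cons_cV (b, x)) => mG.
have G0 b : 0 <= G b by exact: integral_ge0.
transitivity (\int[lebesgue_measure]_b ((c ^- n)%:E * G (c * b + a1)%R)).
  apply: eq_integral => b _.
  rewrite /G -(IH a2)//; last exact: measurable_cons_cVr.
  apply: eq_integral => x _; congr f.
  by rewrite -cons_cVD -cons_cVZ; congr (_ + _)%R; rewrite -surjective_pairing uncons_cVK.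
have mG' : measurable_fun setT (fun b : measurableTypeR R => G (c * b + a1)%R).
  exact: (measurableT_comp mG (measurable_affineR c a1)).
transitivity ((c ^- n)%:E * \int[lebesgue_measure]_b G (c * b + a1)%R).
  exact: ge0_integralZl.
rewrite (lebesgue_integral_affine a1 c0 mG G0).
by rewrite muleA -EFinM -invfM exprSr.
Qed.

Lemma integral_borel_Rn_shift n (a : 'cV[R]_n) (f : 'cV[R]_n -> \bar R) :
  measurable_fun setT f -> (forall x, 0 <= f x) ->
  \int[borel_Rn n]_x f (x + a)%R = \int[borel_Rn n]_x f x.
Proof.
move=> mf f0; have := integral_borel_Rn_affine a (@ltr01 R) mf f0.
by rewrite expr1n invr1 mul1e; under eq_integral do rewrite scale1r.
Qed.

Lemma borel_Rn_contract n (c : R) (a : 'cV[R]_n) (A : set 'cV[R]_n) :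
  (0 < c)%R -> measurable A ->
  borel_Rn n [set x | A (c *: x + a)%R] = (c ^- n)%:E * borel_Rn n A.
Proof.
move=> c0 mA; set B := [set x | _].
have mB : measurable B.
  by have := measurable_affine_cV c a measurableT mA; rewrite setTI.
have mI : measurable_fun setT (EFin \o (\1_A : 'cV[R]_n -> R)).
  exact/measurable_EFinP/measurable_indic.
have I0 x : 0 <= (\1_A x)%:E :> \bar R by rewrite lee_fin.
rewrite -(integral_indicT _ mA) -(integral_indicT _ mB).
exact: (integral_borel_Rn_affine a c0 mI I0).
Qed.

(** By Tonelli, from the coordinate of a nonzero entry of [u]. *)
Lemma borel_Rn_hyperplane n (u : 'cV[R]_n) (b : R) : u != 0%R ->
  borel_Rn n [set x | dot u x = b] = 0.
Proof.
have mH m (v : 'cV[R]_m) c : measurable [set x | dot v x = c].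
  by have := measurable_dot v measurableT (measurable_set1 c); rewrite setTI.
elim: n u b => [|n IH] u b u0.
  by case/eqP: u0; apply/colP => -[].
have mI : measurable_fun setT
    (EFin \o (\1_[set x | dot u x = b] : 'cV[R]_n.+1 -> R)).
  by apply/measurable_EFinP; apply: measurable_indic; apply: (mH n.+1 u b).
have I0 x : 0 <= (EFin \o (\1_[set x | dot u x = b] : 'cV[R]_n.+1 -> R)) x.
  by rewrite lee_fin.
rewrite -(integral_indicT (borel_Rn n.+1) (mH _ u b)) (ge0_integral_borel_RnS mI I0).
have uE := uncons_cVK u; case: (uncons_cV u) uE => u1 u2 uE.
have [u20|u20] := eqVneq u2 0%R; last first.
  apply: integral0_eq => a _.
  rewrite -[RHS](IH u2 (b - u1 * a)%R u20) -(integral_indicT (borel_Rn n) (mH _ _ _)).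
  apply: eq_integral => x _; congr EFin; rewrite !indicE; congr (_%:R).
  by congr nat_of_bool; apply/idP/idP; rewrite !inE /= -uE dot_cons_cV; lra.
have u10 : u1 != 0%R.
  apply: contra_neq u0 => u10; rewrite -uE u10 u20.
  by apply/colP => i; case: (unliftP ord0 i) => [j ->|->];
    rewrite ?cons_cVS ?cons_cV0 !mxE.
pose N : set (measurableTypeR R) := [set (b / u1)%R].
have mN : measurable N by exact: measurable_set1.
have mG := measurable_integral_cons_cV mI I0.
have N0 : lebesgue_measure N = 0 by exact: lebesgue_measure_set1.
rewrite (ge0_negligible_integral mN measurableT mG _ N0); last first.
  by move=> a _; apply: integral_ge0 => x _; rewrite lee_fin.
apply: integral0_eq => a [_ /= ab]; apply: integral0_eq => x _.
rewrite indicE memNset//= -uE u20 dot_cons_cV dotC dot0r addr0.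
by move=> E'; apply: ab; rewrite /N/= -E' mulrAC divff// mul1r.
Qed.

End borel_Rn_integration.

Section lebesgue_completion.
Context {R : realType} {n : nat}.
Local Open Scope ereal_scope.
Local Notation leb := (@lebesgue_Rn R n).
Let T := caratheodory_type ((@borel_Rn R n)^*)%mu.

Lemma borel_lebesgue_measurable (A : set 'cV[R]_n) :
  measurable A -> measurable (A : set T).
Proof. by move=> mA; apply: sub_caratheodory; exact: sub_sigma_algebra. Qed.

Lemma lebesgue_RnE (A : set 'cV[R]_n) : measurable A -> leb A = borel_Rn n A.
Proof. exact: measurable_mu_extE. Qed.

Lemma borel_lebesgue_measurable_fun d' (T' : measurableType d') (f : 'cV[R]_n -> T') :
  measurable_fun setT f -> measurable_fun (setT : set T) f.
Proof.
move=> mf _ Y mY; apply: borel_lebesgue_measurable.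
by have := mf measurableT Y mY.
Qed.

Lemma ge0_integral_lebesgue_Rn (f : 'cV[R]_n -> \bar R) :
  measurable_fun setT f -> (forall x, 0 <= f x) ->
  \int[leb]_x f x = \int[borel_Rn n]_x f x.
Proof.
move=> mf f0.
pose phi (x : T) : 'cV[R]_n := x.
have mphi : measurable_fun setT phi.
  by move=> _ Y mY; rewrite setTI; exact: borel_lebesgue_measurable.
have := ge0_integral_pushforward mphi leb measurableT mf.
rewrite preimage_setT => <- //.
by apply: eq_measure_integral => A mA _; exact: lebesgue_RnE.
Qed.

(** Completeness of the Lebesgue measure: what happens on a null Borel set is
immaterial. *)
Lemma ae_borel_lebesgue_measurable_fun d' (T' : measurableType d')
    (f g : 'cV[R]_n -> T') (N : set 'cV[R]_n) :
  measurable_fun setT g -> measurable N -> borel_Rn n N = 0 ->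
  (forall x, ~ N x -> f x = g x) -> measurable_fun (setT : set T) f.
Proof.
move=> mg mN N0 fg _ Y mY; rewrite setTI.
have -> : f @^-1` Y = (g @^-1` Y `\` N) `|` (f @^-1` Y `&` N).
  apply/seteqP; split => x /=.
    by move=> fY; have [Nx|Nx] := pselect (N x); [right|left; rewrite -fg].
  by move=> [[gY Nx]|[]//]; rewrite fg.
apply: measurableU.
  apply: borel_lebesgue_measurable; apply: measurableD => //.
  by have := mg measurableT Y mY; rewrite setTI.
apply: (@measure_is_complete_caratheodory R 'cV[R]_n ((@borel_Rn R n)^*)%mu).
exists N; split => //; first exact: borel_lebesgue_measurable.
by have := lebesgue_RnE mN; rewrite N0.
Qed.

End lebesgue_completion.

(** * The Prekopa-Leindler inequality *)

Section prekopa_leindler_line.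
Context {R : realType}.
Local Notation mu := (@lebesgue_measure R).
Local Open Scope ereal_scope.

Let measurable_affine_preimage (c a : R) (A : set R) :
  measurable A -> measurable [set x | A (c * x + a)%R].
Proof.
by move=> mA; have := measurable_affineR c a measurableT mA; rewrite setTI.
Qed.

Let lebesgue_affine_preimage (c a : R) (A : set R) : (0 < c)%R ->
  measurable A -> mu [set x | A (c * x + a)%R] = (c^-1)%:E * mu A.
Proof.
move=> c0 mA.
have mI : measurable_fun setT (EFin \o (\1_A : measurableTypeR R -> R)).
  exact/measurable_EFinP/measurable_indic.
have I0 x : 0 <= (\1_A x)%:E :> \bar R by rewrite lee_fin.
rewrite -(integral_indicT mu mA).
rewrite -(integral_indicT mu (measurable_affine_preimage c a mA)).
exact: (lebesgue_integral_affine a c0 mI I0).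
Qed.

Let compact_max (K : set R) : compact K -> K !=set0 ->
  exists2 m, K m & forall x, K x -> (x <= m)%R.
Proof.
move=> cK K0; have := @compact_EVT_max _ R id K K0 cK.
move=> []; first by apply: continuous_subspaceT => x; exact: cvg_id.
by move=> m /[!inE] Km h; exists m => // x Kx; apply: h; rewrite inE.
Qed.

Let compact_min (K : set R) : compact K -> K !=set0 ->
  exists2 m, K m & forall x, K x -> (m <= x)%R.
Proof.
move=> cK K0; have := @compact_EVT_min _ R id K K0 cK.
move=> []; first by apply: continuous_subspaceT => x; exact: cvg_id.
by move=> m /[!inE] Km h; exists m => // x Kx; apply: h; rewrite inE.
Qed.

(** The half-sums of [A] with the least point of [B] lie to the left of the
half-sums of [B] with the greatest point of [A]. *)
Let brunn_minkowski_compact (A B C : set R) :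
  compact A -> compact B -> measurable C -> A !=set0 -> B !=set0 ->
  (forall a b, A a -> B b -> C ((a + b) / 2)%R) ->
  mu A + mu B <= 2%:E * mu C.
Proof.
move=> cA cB mC A0 B0 ABC.
have [a Aa maxa] := compact_max cA A0; have [b Bb minb] := compact_min cB B0.
have mA := compact_measurable cA; have mB := compact_measurable cB.
pose S := [set x | A (2 * x + - b)%R]; pose T := [set x | B (2 * x + - a)%R].
have mS : measurable S by exact: measurable_affine_preimage.
have mT : measurable T by exact: measurable_affine_preimage.
have muS : mu A = 2%:E * mu S.
  by rewrite lebesgue_affine_preimage// muleA -EFinM divff// mul1e.
have muT : mu B = 2%:E * mu T.
  by rewrite lebesgue_affine_preimage// muleA -EFinM divff// mul1e.
rewrite muS muT -ge0_muleDr//; apply: lee_pmul => //; first by rewrite adde_ge0.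
have p0 : mu (S `&` T) = 0.
  apply: (subset_measure0 _ _ _ (lebesgue_measure_set1 ((a + b) / 2)%R)) => //.
    exact: measurableI.
  move=> x [/maxa h1 /minb h2] /=; lra.
have -> : mu S = mu (S `\` T).
  apply: (etrans (@measureDI _ _ _ mu _ _ mS mT)); rewrite -[RHS]adde0.
  by congr (_ + _); exact: p0.
rewrite -measureU//; last 2 first.
- exact: measurableD.
- by apply/seteqP; split => // x [[]].
apply: (@le_measure _ _ _ mu); rewrite ?inE//.
  by apply: measurableU => //; exact: measurableD.
move=> x [[Sx _]|Tx].
  by have := ABC _ _ Sx Bb; congr C; field.
by have := ABC _ _ Aa Tx; congr C; field.
Qed.

(** Reduction to compact sets by inner regularity, in one variable after the other;
the points of [A] and [B] serve to replace an empty compact set by a singleton. *)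
Lemma brunn_minkowski_line (A B C : set R) :
  measurable A -> measurable B -> measurable C -> A !=set0 -> B !=set0 ->
  (forall a b, A a -> B b -> C ((a + b) / 2)%R) ->
  mu A + mu B <= 2%:E * mu C.
Proof.
move=> mA mB mC [a0 Aa0] [b0 Bb0] ABC.
have reg (D : set R) d0 (x : \bar R) : measurable D -> D d0 ->
    (forall K, compact K -> K `<=` D -> K !=set0 -> mu K <= x) -> mu D <= x.
  move=> mD Dd0 h; rewrite (lebesgue_regularity_inner_sup mD).
  apply: ge_ereal_sup => _ [K [cK KD] <-].
  have [->|/set0P K0] := eqVneq K set0; last exact: h.
  rewrite measure0 -(lebesgue_measure_set1 d0); apply: h.
  - exact: compact_set1.
  - by move=> _ ->.
  - by exists d0.
have [->|Cfin] := eqVneq (mu C) +oo.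
  by rewrite mulry gtr0_sg// mul1e leey.
have {}Cfin : 2%:E * mu C \is a fin_num.
  by rewrite fin_numM// ge0_fin_numE// ltey.
have KL K L : compact K -> K `<=` A -> K !=set0 ->
    compact L -> L `<=` B -> L !=set0 -> mu K + mu L <= 2%:E * mu C.
  move=> cK KA K0 cL LB L0; apply: brunn_minkowski_compact => //.
  by move=> a b /KA Aa /LB Bb; exact: ABC.
have Kfin K : compact K -> K `<=` A -> K !=set0 -> mu K \is a fin_num.
  move=> cK KA K0; rewrite ge0_fin_numE//; move: Cfin; rewrite ge0_fin_numE//.
    2: by rewrite mule_ge0.
  apply: le_lt_trans; apply: (le_trans _ (KL _ [set b0] cK KA K0 _ _ _)).
  - by rewrite lebesgue_measure_set1 adde0.
  - exact: compact_set1.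
  - by move=> _ ->.
  - by exists b0.
have KB K : compact K -> K `<=` A -> K !=set0 -> mu K + mu B <= 2%:E * mu C.
  move=> cK KA K0; rewrite addeC -leeBrDr ?Kfin//.
  apply: (reg _ b0) => // L cL LB L0.
  by rewrite leeBrDr ?Kfin// addeC; exact: KL.
have Bfin : mu B \is a fin_num.
  rewrite ge0_fin_numE//; move: Cfin; rewrite ge0_fin_numE ?mule_ge0//.
  apply: le_lt_trans; apply: (le_trans _ (KB [set a0] _ _ _)).
  - by rewrite lebesgue_measure_set1 add0e.
  - exact: compact_set1.
  - by move=> _ ->.
  - by exists a0.
rewrite -leeBrDr//; apply: (reg _ a0) => // K cK KA K0.
by rewrite leeBrDr//; exact: KB.
Qed.

Let T : measurableType _ := (measurableTypeR R * measurableTypeR R)%type.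
Let hypograph (F : R -> \bar R) : set T := [set p | (0 <= p.2)%R /\ p.2%:E < F p.1].

Let measurable_hypograph F : measurable_fun setT F -> measurable (hypograph F).
Proof.
move=> mF.
rewrite (_ : hypograph F = ([set: T] `&` [set p | (0%:E <= p.2%:E)]) `&`
    ([set: T] `&` [set p | p.2%:E < F p.1])); last first.
  by apply/seteqP; split => p /=; [move=> [] ? ?|move=> [[_ ?] [_ ?]]].
apply: measurableI; [apply: measurable_lee|apply: measurable_lte] => //.
- by apply/measurable_EFinP; exact: measurable_snd.
- by apply/measurable_EFinP; exact: measurable_snd.
- by apply: (measurableT_comp mF); exact: measurable_fst.
Qed.

Lemma measurable_layer (F : R -> \bar R) : measurable_fun setT F ->
  measurable_fun setT
    (fun r : measurableTypeR R => mu [set x | (0 <= r)%R /\ r%:E < F x]).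
Proof.
move=> /measurable_hypograph mE.
have := measurable_fun_ysection mu mE; congr measurable_fun.
by apply/funext => r /=; rewrite ysectionE.
Qed.

(** Tonelli's theorem for the measure of the hypograph of [F]. *)
Lemma layer_cake (F : R -> \bar R) : measurable_fun setT F -> (forall x, 0 <= F x) ->
  \int[mu]_x F x = \int[mu]_r mu [set x | (0 <= r)%R /\ r%:E < F x].
Proof.
move=> mF F0; have mE := measurable_hypograph mF.
pose E := hypograph F.
have mSx x : measurable [set r : measurableTypeR R | (0 <= r)%R /\ r%:E < F x].
  by have := measurable_xsection x mE; rewrite xsectionE.
have mSr r : measurable [set x : measurableTypeR R | (0 <= r)%R /\ r%:E < F x].
  by have := measurable_ysection r mE; rewrite ysectionE.
transitivity (\int[mu]_x \int[mu]_r (\1_E (x, r))%:E).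
  apply: eq_integral => x _.
  have -> : \int[mu]_r (\1_E (x, r))%:E =
     mu [set r : measurableTypeR R | (0 <= r)%R /\ r%:E < F x].
    by rewrite -integral_indicT.
  have := F0 x; case: (F x) => [r| |//].
    rewrite lee_fin => r0.
    rewrite (_ : [set _ | _] = `[0%R, r[%classic); last first.
      by apply/seteqP; split => s /=; rewrite in_itv/= lte_fin => /andP.
    rewrite lebesgue_measure_itv/= lte_fin; case: ltP => [_|r0']; first by rewrite sube0.
    by congr EFin; apply/le_anti; rewrite r0 r0'.
  rewrite (_ : [set _ | _] = `[0%R, +oo[%classic); last first.
    by apply/seteqP; split => s /=; rewrite in_itv/= andbT ltry => // -[].
  by rewrite lebesgue_measure_itv/= ltry.
have mf : measurable_fun [set: T] (EFin \o (\1_E : T -> R)).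
  exact/measurable_EFinP/measurable_indic.
rewrite (@fubini_tonelli _ _ (measurableTypeR R) (measurableTypeR R) R mu mu _ mf).
  by apply: eq_integral => r _; rewrite -(integral_indicT mu (mSr r)).
by move=> p; rewrite lee_fin.
Qed.

(** Superlevel sets of [f], [g], [h] at proportional heights satisfy the
hypothesis of the Brunn-Minkowski inequality; the layer cake formula turns the
resulting arithmetic mean into a lower bound for the integral of [h], and the
arithmetic mean dominates the geometric one.  Heights are measured in proportion
to the suprema of [f] and [g], so that their superlevel sets are empty from the
same height on: the Brunn-Minkowski inequality needs both to be nonempty. *)
Lemma prekopa_leindler_line_bounded (f g : R -> R) (h : R -> \bar R) (M : R) :
  measurable_fun setT f -> measurable_fun setT g -> measurable_fun setT h ->
  (forall x, 0 <= f x <= M)%R -> (forall x, 0 <= g x <= M)%R ->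
  (forall x, 0 <= h x) ->
  (forall x y, (f x * g y)%:E <= h ((x + y) / 2)%R * h ((x + y) / 2)%R) ->
  (\int[mu]_x (f x)%:E) * (\int[mu]_x (g x)%:E) <=
  (\int[mu]_x h x) * (\int[mu]_x h x).
Proof.
move=> mf mg mh f0M g0M h0 fgh.
have f0 x : (0 <= f x)%R by have /andP[] := f0M x.
have g0 x : (0 <= g x)%R by have /andP[] := g0M x.
have Ih0 : 0 <= \int[mu]_x h x by exact: integral_ge0.
have sup_pos (k : R -> R) : (forall x, 0 <= k x <= M)%R ->
    (forall x, k x = 0%R) \/
    exists a : R, [/\ (0 < a)%R, forall x, (k x <= a)%R &
      forall r, (r < 1)%R -> exists x, (a * r < k x)%R].
  move=> k0M.
  have [k0|/existsNP[x0 kx0]] := pselect (forall x, k x = 0%R); first by left.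
  right; exists (sup (range k)).
  have ub x : (k x <= sup (range k))%R.
    apply: sup_upper_bound; last by exists x.
    split; first by exists (k x), x.
    by exists M => _ [y _ <-]; have /andP[] := k0M y.
  have a0 : (0 < sup (range k))%R.
    apply: lt_le_trans (ub x0); rewrite lt_def; have /andP[-> _] := k0M x0.
    by rewrite andbT; exact/eqP.
  split => // r r1.
  have : (sup (range k) * r < sup (range k))%R by rewrite gtr_pMr.
  move=> /sup_gt; case; first by exists (k x0), x0.
  by move=> _ [x _ <-] ?; exists x.
have [f00|[a [a0 fa supf]]] := sup_pos f f0M.
  by rewrite integral0_eq ?mul0e ?mule_ge0// => x _; rewrite f00.
have [g00|[b [b0 gb supg]]] := sup_pos g g0M.
  rewrite [X in _ * X]integral0_eq ?mule0 ?mule_ge0// => x _.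
  by rewrite g00.
(* With [c ^ 2 = a * b], heights above [a r] and [b r] for [f] and [g] force
heights above [c r] for [h]. *)
pose c := Num.sqrt (a * b).
have c0 : (0 < c)%R by rewrite sqrtr_gt0 mulr_gt0.
have cE : (c * c = a * b)%R by rewrite -expr2 sqr_sqrtr// ltW// mulr_gt0.
pose L (k : R -> \bar R) (r : R) := mu [set x | (0 <= r)%R /\ r%:E < k x].
have mset (k : R -> \bar R) r : measurable_fun setT k ->
    measurable [set x | (0 <= r)%R /\ r%:E < k x].
  move=> mk; have [r0|r0] := leP 0%R r.
    rewrite (_ : [set _ | _] = setT `&` [set x | (cst r%:E) x < k x]).
      exact: measurable_lte.
    by apply/seteqP; split => x [].
  rewrite (_ : [set _ | _] = set0)//.
  by apply/seteqP; split => x //= -[].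
have L0 k r : 0 <= L k r by exact: measure_ge0.
have mL (k : R -> \bar R) : measurable_fun setT k -> measurable_fun setT (L k).
  exact: measurable_layer.
have scale (k : R -> \bar R) s : (0 < s)%R -> measurable_fun setT k ->
    (forall x, 0 <= k x) ->
    \int[mu]_r L k (s * r)%R = (s^-1)%:E * \int[mu]_x k x.
  move=> s0 mk k0; rewrite [in RHS]layer_cake//.
  have := lebesgue_integral_affine 0 s0 (mL k mk) (L0 k).
  under eq_integral do rewrite addr0.
  by [].
have mEf : measurable_fun setT (EFin \o f) by exact/measurable_EFinP.
have mEg : measurable_fun setT (EFin \o g) by exact/measurable_EFinP.
have mscale (k : R -> \bar R) s : measurable_fun setT k -> (forall x, 0 <= k x) ->
    measurable_fun setT (fun r : measurableTypeR R => L k (s * r)%R).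
  move=> mk k0; have := measurableT_comp (mL k mk) (measurable_affineR s 0).
  by under eq_fun do rewrite /= addr0.
have key r : L (EFin \o f) (a * r)%R + L (EFin \o g) (b * r)%R <= 2%:E * L h (c * r)%R.
  have empty (k : R -> R) s : (0 < s)%R -> (forall x, k x <= s)%R ->
      (r < 0)%R || (1 <= r)%R -> L (EFin \o k) (s * r)%R = 0.
    move=> s0 ks r01; rewrite /L (_ : [set _ | _] = set0) ?measure0//.
    apply/seteqP; split => x //= []; rewrite pmulr_rge0// lte_fin => r0.
    move: r01; rewrite ltNge r0/= => r1; apply/negP; rewrite -leNgt.
    by rewrite (le_trans (ks x))// ler_peMr// ltW.
  have [r01|] := boolP ((r < 0)%R || (1 <= r)%R).
    by rewrite !empty// adde0 mule_ge0.
  rewrite negb_or -leNgt -ltNge => /andP[r0 r1].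
  apply: brunn_minkowski_line; [exact: mset|exact: mset|exact: mset| | |].
  - by have [x hx] := supf r r1; exists x; split => //; rewrite mulr_ge0// ltW.
  - by have [x hx] := supg r r1; exists x; split => //; rewrite mulr_ge0// ltW.
  move=> x y [_ /= fx] [_ /= gy]; rewrite !lte_fin in fx gy.
  split; first by rewrite mulr_ge0// ltW.
  rewrite ltNge; apply/negP => hc.
  have : (f x * g y)%:E <= (c * r)%:E * (c * r)%:E.
    by apply: (le_trans (fgh x y)); rewrite lee_pmul.
  rewrite -EFinM lee_fin leNgt => /negP; apply.
  rewrite mulrACA cE -mulrACA.
  by apply: ltr_pM; rewrite ?mulr_ge0 ?(ltW a0) ?(ltW b0).
have : (a^-1)%:E * \int[mu]_x (EFin \o f) x + (b^-1)%:E * \int[mu]_x (EFin \o g) x <=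
    2%:E * ((c^-1)%:E * \int[mu]_x h x).
  rewrite -!scale//.
  rewrite -ge0_integralD//; [|exact: mscale|exact: mscale].
  rewrite -ge0_integralZl//; [|exact: mscale].
  apply: ge0_le_integral => //.
  - by move=> r _; rewrite adde_ge0.
  - by apply: emeasurable_funD; exact: mscale.
  - by apply: measurable_funeM; exact: mscale.
move: Ih0; case: (\int[mu]_x h x) => [H| |//]; last first.
  by move=> _ _; rewrite mulyy leey.
rewrite lee_fin => H0.
have If0 : 0 <= \int[mu]_x (EFin \o f) x by apply: integral_ge0 => x _; rewrite lee_fin.
have Ig0 : 0 <= \int[mu]_x (EFin \o g) x by apply: integral_ge0 => x _; rewrite lee_fin.
rewrite -[in X in _ -> X]/(\int[mu]_x (EFin \o f) x) -[X in _ -> _ * X <= _]/(\int[mu]_x (EFin \o g) x).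
move: If0 Ig0.
case: (\int[mu]_x (EFin \o f) x) => [F| |//]; last first.
  move=> _ G0; rewrite mulry gtr0_sg ?invr_gt0// mul1e addye ?leye_eq//.
  by rewrite gt_eqF// (lt_le_trans (ltNyr 0))// mule_ge0// lee_fin invr_ge0 ltW.
rewrite lee_fin => F0.
case: (\int[mu]_x (EFin \o g) x) => [G| |//]; last first.
  by move=> _; rewrite mulry gtr0_sg ?invr_gt0// mul1e addey.
rewrite lee_fin => G0; rewrite -!EFinM -EFinD !lee_fin => le.
have : ((a^-1 * F) * (b^-1 * G) <= (c^-1 * H) * (c^-1 * H))%R.
  have a1 : (0 <= a^-1 * F)%R by rewrite mulr_ge0// invr_ge0 ltW.
  have b1 : (0 <= b^-1 * G)%R by rewrite mulr_ge0// invr_ge0 ltW.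
  have c1 : (0 <= c^-1 * H)%R by rewrite mulr_ge0// invr_ge0 ltW.
  move: (a^-1 * F)%R (b^-1 * G)%R (c^-1 * H)%R a1 b1 c1 le => u v w u0 v0 w0 le.
  have := sqr_ge0 (u - v)%R; nra.
rewrite !(mulrACA _ _ _^-1%R) -!invfM cE ler_pM2l// invr_gt0 mulr_gt0//.
Qed.

(** Truncation of [f] and [g] and monotone convergence. *)
Lemma prekopa_leindler_line (f g h : R -> \bar R) :
  measurable_fun setT f -> measurable_fun setT g -> measurable_fun setT h ->
  (forall x, 0 <= f x) -> (forall x, 0 <= g x) -> (forall x, 0 <= h x) ->
  (forall x y, f x * g y <= h ((x + y) / 2)%R * h ((x + y) / 2)%R) ->
  (\int[mu]_x f x) * (\int[mu]_x g x) <= (\int[mu]_x h x) * (\int[mu]_x h x).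
Proof.
move=> mf mg mh f0 g0 h0 fgh.
have If0 : 0 <= \int[mu]_x f x by exact: integral_ge0.
have Ig0 : 0 <= \int[mu]_x g x by exact: integral_ge0.
have Ih0 : 0 <= \int[mu]_x h x by exact: integral_ge0.
have [->|If] := eqVneq (\int[mu]_x f x) 0; first by rewrite mul0e mule_ge0.
have [->|Ig] := eqVneq (\int[mu]_x g x) 0; first by rewrite mule0 mule_ge0.
pose tr (k : R -> \bar R) (n : nat) x := mine (k x) n%:R%:E.
have tr0 k n x : (forall x, 0 <= k x) -> 0 <= tr k n x.
  by move=> k0; rewrite /tr le_min k0 lee_fin ler0n.
have trE k n x : (forall x, 0 <= k x) -> tr k n x = (fine (tr k n x))%:E.
  move=> k0; rewrite fineK// ge0_fin_numE ?tr0//.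
  by rewrite (le_lt_trans _ (ltry n%:R))// /tr ge_min lexx orbT.
have mtr k n : measurable_fun setT k -> measurable_fun setT (tr k n).
  by move=> mk; exact: measurable_mine.
have cvtr (k : R -> \bar R) : measurable_fun setT k -> (forall x, 0 <= k x) ->
    \int[mu]_x tr k n x @[n --> \oo] --> \int[mu]_x k x.
  move=> mk k0.
  have klim x : tr k n x @[n --> \oo] --> k x.
    have := k0 x; rewrite /tr; case: (k x) => [r| |//] r0.
      apply: cvg_near_cst; near=> n; rewrite min_l// lee_fin; near: n.
      exact: nbhs_infty_ger.
    under eq_fun do rewrite min_r ?leey//.
    exact/cvgenyP.
  rewrite (_ : \int[mu]_x k x = \int[mu]_x limn (tr k ^~ x)); last first.
    by apply: eq_integral => x _; apply/esym/cvg_lim.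
  apply: cvg_monotone_convergence => //.
  - by move=> n; exact: mtr.
  - by move=> n x _; exact: tr0.
  - move=> x _ m n mn; rewrite /tr le_min !ge_min lexx/=.
    by rewrite lee_fin ler_nat mn orbT.
have cv : (\int[mu]_x tr f n x) * (\int[mu]_x tr g n x) @[n --> \oo] -->
    (\int[mu]_x f x) * (\int[mu]_x g x).
  apply: cvgeM; [|exact: cvtr|exact: cvtr].
  by move: If Ig; case: (\int[mu]_x f x) => [r| |]; case: (\int[mu]_x g x) => [r'| |].
rewrite -(cvg_lim _ cv)//; apply: lime_le; first by apply/cvg_ex; eexists; exact: cv.
apply: nearW => n.
under eq_integral do rewrite trE//.
under [X in _ * X]eq_integral do rewrite trE//.
apply: (@prekopa_leindler_line_bounded _ _ _ n%:R) => //.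
- by apply: measurableT_comp => //; exact: mtr.
- by apply: measurableT_comp => //; exact: mtr.
- move=> x; rewrite fine_ge0 ?tr0//= -lee_fin -trE// /tr ge_min lexx orbT//.
- move=> x; rewrite fine_ge0 ?tr0//= -lee_fin -trE// /tr ge_min lexx orbT//.
- move=> x y; rewrite EFinM -!trE//; apply: (le_trans _ (fgh x y)).
  by apply: lee_pmul; rewrite ?tr0// /tr ge_min lexx.
Unshelve. all: by end_near. Qed.

End prekopa_leindler_line.

(** Integrating out the last coordinates turns an instance of the hypothesis
into one on the line, by induction on the dimension. *)
Lemma prekopa_leindler (R : realType) n (f g h : 'cV[R]_n -> \bar R) :
  measurable_fun setT f -> measurable_fun setT g -> measurable_fun setT h ->
  (forall x, 0 <= f x)%E -> (forall x, 0 <= g x)%E -> (forall x, 0 <= h x)%E ->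
  (forall x y, f x * g y <= h (2^-1 *: (x + y))%R * h (2^-1 *: (x + y))%R)%E ->
  (\int[borel_Rn n]_x f x * \int[borel_Rn n]_x g x <=
   \int[borel_Rn n]_x h x * \int[borel_Rn n]_x h x)%E.
Proof.
elim: n f g h => [|n IH] f g h mf mg mh f0 g0 h0 fgh.
  have E k : measurable_fun setT k ->
      (\int[borel_Rn 0]_x k x)%E = k (0 : 'cV[R]_0) :> \bar R.
    by move=> mk; rewrite integral_dirac//= diracT mul1e.
  by rewrite !E//; have := fgh 0 0; rewrite addr0 scaler0.
rewrite !ge0_integral_borel_RnS//.
apply: prekopa_leindler_line.
- exact: measurable_integral_cons_cV.
- exact: measurable_integral_cons_cV.
- exact: measurable_integral_cons_cV.
- by move=> a; exact: integral_ge0.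
- by move=> a; exact: integral_ge0.
- by move=> a; exact: integral_ge0.
move=> a b; apply: IH => //.
- exact: measurable_cons_cVr.
- exact: measurable_cons_cVr.
- exact: measurable_cons_cVr.
move=> x y; rewrite (mulrC (a + b)) -cons_cVZ -cons_cVD; exact: fgh.
Qed.

(** * Boundaries of convex sets *)

Section convex_sets.
Context {R : realType} {n : nat}.
Implicit Types (K : set 'cV[R]_n) (x y z p : 'cV[R]_n).

Lemma ball_cVP x (e : R) y : 0 < e ->
  ball x e y <-> forall i, `|x i ord0 - y i ord0| < e.
Proof.
move=> e0; split=> [[_ h] i|h]; first exact: h.
by split => // i j; rewrite (ord1 j); exact: h.
Qed.

Lemma measurable_ball_cV x (e : R) : measurable (ball x e).
Proof.
have [e0|e0] := ltP 0 e; last first.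
  rewrite (_ : ball x e = set0)//; apply/seteqP; split => // y [].
  by rewrite ltNge e0.
rewrite (_ : ball x e = \bigcap_(i in [set: 'I_n])
    ((fun y : 'cV[R]_n => y i ord0) @^-1` ball (x i ord0) e)).
  apply: fin_bigcap_measurable => // i _; rewrite -[X in measurable X]setTI.
  by apply: measurable_coor => //; exact: measurable_ball.
apply/seteqP; split => y; first by move=> /(ball_cVP _ _ e0) h i _; exact: h.
by move=> h; apply/(ball_cVP _ _ e0) => i; exact: (h i I).
Qed.

(** The interior is the union of the countably many balls with rational data that
it contains. *)
Lemma measurable_interior_cV (A : set 'cV[R]_n) : measurable A°.
Proof.
pose B (q : 'cV[rat]_n * nat) : set 'cV[R]_n := ball (map_mx ratr q.1 : 'cV[R]_n) q.2.+1%:R^-1.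
pose F k := if unpickle k is Some q then
  if pselect (B q `<=` A°) then B q else set0 else set0.
have -> : A° = \bigcup_k F k.
  apply/seteqP; split => [x Ax|x [k _]]; last first.
    rewrite /F; case: unpickle => // q; case: pselect => [h|//] /=; exact: h.
  have /nbhs_ballP[e /= e0 eA] : nbhs x A by [].
  have e4 : 0 < e / 4 by rewrite divr_gt0.
  have [k ke] : exists k : nat, k.+1%:R^-1 < e / 4.
    exists (Num.truncn (e / 4)^-1); rewrite invf_plt ?posrE ?ltr0n//.
    exact: truncnS_gt.
  have [d dE] : exists d : R, k.+1%:R^-1 = d by exists k.+1%:R^-1.
  have d0 : 0 < d by rewrite -dE invr_gt0.
  rewrite dE in ke.
  have /choice[q qx] : forall i, exists q : rat, `|x i ord0 - ratr q| < d.
    move=> i; have : x i ord0 - d < x i ord0 + d by lra.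
    move=> /rat_in_itvoo[q]; rewrite in_itv/= => /andP[h1 h2].
    by exists q; rewrite ltr_norml; apply/andP; split; lra.
  pose Q := (\col_i q i, k).
  have BQ y : B Q y <-> forall i, `|ratr (q i) - y i ord0| < d.
    rewrite /B /Q dE; split; first by move=> /(ball_cVP _ _ d0) h i; have := h i; rewrite !mxE.
    by move=> h; apply/(ball_cVP _ _ d0) => i; rewrite !mxE.
  have QA : B Q `<=` A°.
    move=> y /BQ yQ; apply/nbhs_ballP; exists (e / 4) => //= z.
    move=> /(ball_cVP _ _ e4) yz; apply: eA; apply/(ball_cVP _ _ e0) => i.
    have := qx i; have := yQ i; have := yz i.
    rewrite !ltr_norml => /andP[? ?] /andP[? ?] /andP[? ?]; apply/andP; split; lra.
  exists (pickle Q) => //; rewrite /F pickleK; case: pselect => [h|//] /=.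
  by apply/BQ => i; rewrite distrC.
apply: bigcupT_measurable => k; rewrite /F; case: unpickle => // q.
by case: pselect => [h|h] //=; exact: measurable_ball_cV.
Qed.

Lemma measurable_closure_cV (A : set 'cV[R]_n) : measurable (closure A).
Proof.
by rewrite -[closure A]setCK -interiorC; apply: measurableC; exact: measurable_interior_cV.
Qed.

Definition convex_cV K := forall x y (l : R), 0 <= l <= 1 -> K x -> K y ->
  K (l *: x + (1 - l) *: y).

(** A small perturbation of the image of [x] is the image of a nearby point of
[K] under a contraction centered near [p]. *)
Lemma convex_closure_contract K p (r : R) x (s : R) :
  convex_cV K -> 0 < r -> ball p r `<=` K -> closure K x -> 0 < s <= 1 ->
  K° ((1 - s) *: x + s *: p).
Proof.
move=> cK r0 pK clx /andP[s0 s1].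
have sr : 0 < s * r / 2 by rewrite divr_gt0// mulr_gt0.
apply/nbhs_ballP; exists (s * r / 2) => //= z /(ball_cVP _ _ sr) yz.
have [x' [Kx' /(ball_cVP _ _ sr) xx']] := clx _ (nbhsx_ballx x _ sr).
have -> : z = (1 - s) *: x' + (1 - (1 - s)) *: (s^-1 *: (z - (1 - s) *: x')).
  rewrite (_ : 1 - (1 - s) = s); last by ring.
  by rewrite scalerA divff ?gt_eqF// scale1r addrC subrK.
apply: cK => //; first by apply/andP; split; lra.
apply: pK; apply/(ball_cVP _ _ r0) => i.
have := yz i; have := xx' i; rewrite !mxE.
move: (x i _) (x' i _) (z i _) (p i _) => a a' b c h1 h2.
rewrite -(ltr_pM2l s0) -{1}(gtr0_norm s0) -normrM.
have -> : s * (c - s^-1 * (b - (1 - s) * a')) =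
    ((1 - s) * a + s * c - b) - (1 - s) * (a - a') by field; lra.
apply: (le_lt_trans (ler_normB _ _)); rewrite normrM.
have : `|1 - s| * `|a - a'| <= `|a - a'|.
  by rewrite ler_piMl// ger0_norm; lra.
by lra.
Qed.

Lemma borel_Rn_ball_fin x (e : R) : (borel_Rn n (ball x e) < +oo)%E.
Proof.
have [e0|e0] := ltP 0 e; last first.
  rewrite (_ : ball x e = set0) ?measure0//; apply/seteqP; split => // y [].
  by rewrite ltNge e0.
have := @lebesgue_Rn_box R n (x - const_mx e) (x + const_mx e).
set box := (X in lebesgue_Rn n X) => h.
have mb : measurable box.
  rewrite (_ : box = \bigcap_(i in [set: 'I_n]) ((fun y : 'cV[R]_n => y i ord0) @^-1`
      `[(x - const_mx e) i ord0, (x + const_mx e) i ord0])).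
    apply: fin_bigcap_measurable => // i _; rewrite -[X in measurable X]setTI.
    by apply: measurable_coor => //; exact: measurable_itv.
  apply/seteqP; split => y; first by move=> h' i _ /=; rewrite in_itv; exact: h'.
  by move=> h' i; have := h' i I; rewrite /= in_itv.
have sub : ball x e `<=` box.
  move=> y /(ball_cVP _ _ e0) xy i; have := xy i; rewrite !mxE ltr_norml.
  by move=> /andP[? ?]; apply/andP; split; lra.
apply: (@le_lt_trans _ _ (borel_Rn n box)).
  by apply: le_measure; rewrite ?inE//; exact: measurable_ball_cV.
rewrite -lebesgue_RnE// h ?ltry// => i; rewrite !mxE; lra.
Qed.

Lemma bernoulli (s : R) k : 0 <= s <= 1 -> 1 - k%:R * s <= (1 - s) ^+ k.
Proof.
move=> /andP[s0 s1]; elim: k => [|k IH]; first by rewrite mul0r subr0 expr0.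
rewrite exprS.
have h : (1 - s) * (1 - k%:R * s) <= (1 - s) * (1 - s) ^+ k.
  by rewrite ler_wpM2l//; lra.
apply: le_trans h; rewrite -natr1.
have : 0 <= k%:R * (s * s) by rewrite mulr_ge0// mulr_ge0.
lra.
Qed.

(** For [0 < s < 1] the closure is mapped into the interior by the contraction of
ratio [1 - s] centered at [p], so that, within a ball centered at [p], the
measure of the interior is at least [(1 - s)^n] times that of the closure; then
[s] tends to [0]. *)
Lemma convex_boundary_ball K p (r rho : R) :
  convex_cV K -> 0 < r -> ball p r `<=` K ->
  borel_Rn n ((closure K `\` K°) `&` ball p rho) = 0.
Proof.
move=> cK r0 pK.
have [rho0|rho0] := ltP 0 rho; last first.
  rewrite (_ : ball p rho = set0) ?setI0 ?measure0//.
  by apply/seteqP; split => // y []; rewrite ltNge rho0.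
pose A := K° `&` ball p rho; pose B := closure K `&` ball p rho.
have mbp := measurable_ball_cV p rho.
have mA : measurable A by apply: measurableI => //; exact: measurable_interior_cV.
have mB : measurable B by apply: measurableI => //; exact: measurable_closure_cV.
have fin D : D `<=` ball p rho -> measurable D -> borel_Rn n D \is a fin_num.
  move=> Dp mD; rewrite ge0_fin_numE//.
  by apply: le_lt_trans (borel_Rn_ball_fin p rho); apply: le_measure; rewrite ?inE.
have Afin : borel_Rn n A \is a fin_num by apply: fin => // x [].
have Bfin : borel_Rn n B \is a fin_num by apply: fin => // x [].
have AB : A `<=` B.
  by apply: setSI => x /interior_subset; exact: subset_closure.
have key (s : R) : 0 < s < 1 ->
    (1 - s) ^+ n * fine (borel_Rn n B) <= fine (borel_Rn n A).
  move=> /andP[s0 s1]; have s1' : 0 < 1 - s by lra.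
  rewrite -ler_pdivlMl ?exprn_gt0// -lee_fin EFinM !fineK//.
  rewrite -(borel_Rn_contract (s *: p))//; apply: le_measure; rewrite ?inE//.
    by have := measurable_affine_cV (1 - s) (s *: p) measurableT mA; rewrite setTI.
  move=> x [clx /(ball_cVP _ _ rho0) px]; split.
    by apply: convex_closure_contract cK r0 pK clx _; rewrite s0 ltW.
  apply/(ball_cVP _ _ rho0) => i; rewrite !mxE.
  rewrite (_ : _ - _ = (1 - s) * (p i ord0 - x i ord0)); last by ring.
  rewrite normrM gtr0_norm//; apply: le_lt_trans (px i).
  by rewrite ler_piMl//; lra.
have BA : fine (borel_Rn n B) <= fine (borel_Rn n A).
  rewrite -subr_le0.
  apply: (@le0_of_le_small _ _ (n%:R * fine (borel_Rn n B))) => s /andP[s0 s1].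
  have b0 : 0 <= fine (borel_Rn n B) by rewrite fine_ge0.
  (* The value [s = 1] has to be avoided: the ratio [1 - s] must be positive. *)
  have h2 : 0 <= s / 2 <= 1 by apply/andP; split; lra.
  have := key (s / 2); rewrite (_ : 0 < s / 2 < 1); last by apply/andP; split; lra.
  move=> /(_ isT).
  have := ler_wpM2r b0 (bernoulli n h2).
  have : 0 <= n%:R * s * fine (borel_Rn n B) by rewrite !mulr_ge0// ltW.
  lra.
rewrite (_ : _ `&` _ = B `\` A); last first.
  apply/seteqP; split => x.
    by move=> [[? ?] ?]; split => // -[].
  by move=> [[? ?] nA]; split => //; split => // ?; apply: nA.
rewrite measureD//; last by rewrite ltey_eq Bfin.
rewrite (_ : B `&` A = A); last by rewrite setIC; exact/setIidl.
apply/eqP; rewrite eq_le; apply/andP; split.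
  by rewrite sube_le0 -[leLHS]fineK// -[leRHS]fineK// lee_fin.
by rewrite sube_ge0 ?Afin ?orbT//; apply: le_measure; rewrite ?inE.
Qed.

Lemma convex_boundary_solid K : convex_cV K -> K° !=set0 ->
  borel_Rn n (closure K `\` K°) = 0.
Proof.
move=> cK [p /nbhs_ballP[r /= r0 pK]].
have mD : measurable (closure K `\` K°).
  by apply: measurableD; [exact: measurable_closure_cV|exact: measurable_interior_cV].
apply: (measure_negligible mD).
have -> : closure K `\` K° = \bigcup_k ((closure K `\` K°) `&` ball p k%:R).
  apply/seteqP; split => [x Dx|x [k _ []//]].
  pose S := \sum_i `|p i ord0 - x i ord0|.
  exists (Num.truncn S).+1 => //; split => //; apply/ball_cVP => // i.
  apply: le_lt_trans (truncnS_gt S); rewrite /S (bigD1 i)//= lerDl.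
  by apply: sumr_ge0.
apply: negligible_bigcup => k; exists ((closure K `\` K°) `&` ball p k%:R).
split => //; last exact: convex_boundary_ball cK r0 pK.
by apply: measurableI => //; exact: measurable_ball_cV.
Qed.

End convex_sets.

Section flat_convex_sets.
Context {R : realType} {n : nat}.
Implicit Types (K : set 'cV[R]_n) (x y z p : 'cV[R]_n).

Lemma convex_sub_combination K x0 r (d : 'I_r -> 'cV[R]_n) (a : 'I_r -> R) :
  convex_cV K -> K x0 -> (forall i, K (x0 + d i)) -> (forall i, 0 <= a i) ->
  \sum_i a i <= 1 -> K (x0 + \sum_i a i *: d i).
Proof.
move=> cK Kx0; elim: r d a => [|r IH] d a Kd a0 a1.
  by rewrite big_ord0 addr0.
rewrite big_ord_recl; rewrite big_ord_recl in a1.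
set b := a ord0 in a1 *.
pose S := \sum_(i < r) a (lift ord0 i).
have S0 : 0 <= S by apply: sumr_ge0.
have b0 : 0 <= b by exact: a0.
rewrite -/S in a1.
have [b1|b1] := eqVneq b 1.
  have a00 i : a (lift ord0 i) = 0.
    apply: le_anti; rewrite a0 andbT.
    apply: (@le_trans _ _ S); last lra.
    by rewrite /S (bigD1 i)//= lerDl sumr_ge0.
  rewrite b1 scale1r big1 ?addr0// => i _.
  by rewrite a00 scale0r.
have b1' : 0 < 1 - b by move: b1; rewrite neq_lt => /orP[]; lra.
have := IH (d \o lift ord0) (fun i => a (lift ord0 i) / (1 - b)).
have -> : \sum_i a (lift ord0 i) / (1 - b) *: (d \o lift ord0) i =
    (1 - b)^-1 *: \sum_(i < r) a (lift ord0 i) *: d (lift ord0 i).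
  by rewrite scaler_sumr; apply: eq_bigr => i _; rewrite scalerA mulrC.
set T := \sum_(i < r) _ *: _.
move=> h.
have -> : x0 + (b *: d ord0 + T) =
    b *: (x0 + d ord0) + (1 - b) *: (x0 + (1 - b)^-1 *: T).
  rewrite !scalerDr scalerA divff ?gt_eqF// scale1r.
  rewrite addrACA -scalerDl (addrC b) subrK scale1r addrA.
  by rewrite -addrA.
apply: cK; [by rewrite b0; lra|exact: Kd|].
apply: h => [i|i|]; first exact: Kd.
  by rewrite divr_ge0// ltW.
by rewrite -mulr_suml ler_pdivrMr// mul1r -/S; lra.
Qed.

Lemma abs_dot_le (u x : 'cV[R]_n) (e : R) : (forall i, `|x i ord0| <= e) ->
  `|dot u x| <= (\sum_i `|u i ord0|) * e.
Proof.
move=> xe; rewrite dotE mulr_suml; apply: (le_trans (ler_norm_sum _ _ _)).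
by apply: ler_sum => i _; rewrite normrM ler_wpM2l.
Qed.

(** With [x0] as origin and the rows of [M] as axes, [K] contains the points whose
coordinates are nonnegative and have a sum at most [1]; the point with all coordinates [1 / (n + 1)]
is interior to this simplex. *)
Lemma simplex_interior K x0 (M : 'M[R]_n) : convex_cV K -> K x0 ->
  (forall i, K (x0 + (row i M)^T)) -> M \in unitmx -> K° !=set0.
Proof.
move=> cK Kx0 KM Mu.
pose c (x : 'cV[R]_n) i := dot (col i (invmx M)) x.
have cE x : x = \sum_i c x i *: (row i M)^T.
  apply: trmx_inj; rewrite -[LHS](mulmxKV Mu) mulmx_sum_row linear_sum.
  apply: eq_bigr => i _; rewrite linearZ/= trmxK; congr (_ *: _).
  rewrite /c dotE mxE; apply: eq_bigr => j _.
  by rewrite !mxE mulrC.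
pose m : R := n.+1%:R^-1.
have m0 : 0 < m by rewrite invr_gt0.
have nm : n%:R * m = 1 - m.
  rewrite /m -natr1; field; rewrite natr1; by rewrite pnatr_eq0.
pose p := x0 + \sum_i m *: (row i M)^T.
pose T j := \sum_i `|col j (invmx M) i ord0|.
have T0 j : 0 <= T j by apply: sumr_ge0.
(* [S] bounds the coordinates of a vector with entries in [-1, 1], so that a ball
of radius [m ^ 2 / S] perturbs each coordinate by at most [m ^ 2], and
[n (m + m ^ 2) = 1 - m ^ 2]. *)
pose S := 1 + \sum_j T j.
have S0 : 0 < S by rewrite ltr_wpDr// sumr_ge0.
have TS j : T j <= S.
  rewrite /S (bigD1 j)//= addrCA lerDl addr_ge0// sumr_ge0//.
have e0 : 0 < m ^+ 2 / S by rewrite divr_gt0// exprn_gt0.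
exists p; apply/nbhs_ballP; exists (m ^+ 2 / S) => //= z /(ball_cVP _ _ e0) pz.
have cz i : `|c (z - p) i| <= m ^+ 2.
  apply: (le_trans (@abs_dot_le _ _ (m ^+ 2 / S) _)).
    by move=> j; rewrite !mxE distrC; apply/ltW; have := pz j; rewrite !mxE.
  by rewrite -/(T i) mulrCA ler_piMr ?sqr_ge0// ler_pdivrMr// mul1r.
have -> : z = x0 + \sum_i (m + c (z - p) i) *: (row i M)^T.
  under eq_bigr do rewrite scalerDl.
  by rewrite big_split/= -cE addrA -/p addrC subrK.
have m1 : m ^+ 2 <= m.
  by rewrite expr2 ler_piMl ?(ltW m0)// /m invf_le1 ?ltr0n// ler1n.
apply: convex_sub_combination => // [i|].
  by have := cz i; rewrite ler_norml => /andP[]; lra.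
apply: (@le_trans _ _ (\sum_(i < n) (m + m ^+ 2))).
  by apply: ler_sum => i _; have := cz i; rewrite ler_norml => /andP[]; lra.
rewrite sumr_const card_ord -[_ *+ n]mulr_natl mulrDr nm expr2 mulrA nm.
have : 0 <= m * m by rewrite mulr_ge0// ltW.
lra.
Qed.

(** A maximal free family of vectors [x - x0], [x] in [K], either is a basis,
and then [K] contains a solid simplex, or is orthogonal to some [u <> 0]. *)
Lemma convex_flat K x0 : convex_cV K -> K x0 -> ~ (K° !=set0) ->
  exists2 u : 'cV[R]_n, u != 0 & forall x, K x -> dot u x = dot u x0.
Proof.
move=> cK Kx0 K0.
pose P r := `[< exists M : 'M[R]_(r, n),
  row_free M /\ forall i, K (x0 + (row i M)^T) >].
have P0 : exists r, P r.
  exists 0%N; apply/asboolP; exists 0; split; last by case.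
  by rewrite /row_free mxrank0.
have Pn r : P r -> (r <= n)%N.
  by move=> /asboolP[M [/eqP fM _]]; rewrite -{1}fM; exact: rank_leq_col.
case: (ex_maxnP P0 Pn) => r /asboolP[M [fM KM]] maxr.
have inM x : K x -> ((x - x0)^T <= M)%MS.
  move=> Kx; apply: contraT => nM.
  have : P (r + 1)%N.
    apply/asboolP; exists (col_mx M (x - x0)^T); split.
      rewrite /row_free eqn_leq rank_leq_row/= -addsmxE.
      suff : (\rank M < \rank (M + (x - x0)^T)%MS)%N by rewrite (eqP fM) addn1.
      rewrite ltn_neqAle mxrankS ?addsmxSl// andbT.
      apply: contra nM => /eqP rk.
      have : (M == M + (x - x0)^T)%MS by rewrite -(geq_leqif (mxrank_leqif_eq (addsmxSl _ _))) rk.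
      by move=> /andP[_]; apply: submx_trans; exact: addsmxSr.
    move=> i; case: (split_ordP i) => j ->.
      by rewrite rowKu.
    have -> : (row (rshift r j) (col_mx M (x - x0)^T))^T = x - x0.
      by apply/colP => k; rewrite mxE rowKd mxE (ord1 j) mxE.
    by rewrite addrC subrK.
  by move=> /maxr; rewrite addn1 ltnn.
have [rn|rn] := eqVneq r n.
  exfalso; apply: K0; move: M fM KM {inM maxr}; rewrite rn => M fM KM.
  by apply: (simplex_interior cK Kx0 KM); rewrite -row_free_unit.
have : \rank (cokermx M) != 0%N.
  rewrite mxrank_coker (eqP fM) subn_eq0 -ltnNge ltn_neqAle rn.
  by apply: Pn; apply/asboolP; exists M.
rewrite mxrank_eq0 => /eqP/matrixP ck.
have [j [k jk]] : exists j k, cokermx M j k != 0.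
  apply: contrapT => h; apply: ck => j k; rewrite [RHS]mxE; apply/eqP.
  by apply/negPn/negP => jk; apply: h; exists j, k.
exists (col k (cokermx M)).
  apply: contra_neq jk => /colP/(_ j); by rewrite [LHS]mxE [RHS]mxE.
move=> x /inM /submxP[D xD].
apply/eqP; rewrite -subr_eq0 -dotBr dotC /dot xD -mulmxA colE (mulmxA M).
by rewrite mulmx_coker mul0mx mulmx0 mxE.
Qed.

Lemma closure_hyperplane K (u : 'cV[R]_n) (c : R) :
  (forall x, K x -> dot u x = c) -> forall x, closure K x -> dot u x = c.
Proof.
move=> Kc x clx; apply/eqP/negPn/negP => xc.
pose S := 1 + \sum_i `|u i ord0|.
have S0 : 0 < S by rewrite ltr_wpDr// sumr_ge0.
have e0 : 0 < `|dot u x - c| / (2 * S).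
  by rewrite divr_gt0 ?mulr_gt0// normr_gt0 subr_eq0.
have [y [Ky /(ball_cVP _ _ e0) xy]] := clx _ (nbhsx_ballx x _ e0).
have : `|dot u (x - y)| <= (\sum_i `|u i ord0|) * (`|dot u x - c| / (2 * S)).
  by apply: abs_dot_le => i; rewrite !mxE; exact/ltW.
rewrite dotBr (Kc _ Ky).
have h : 0 < `|dot u x - c| by rewrite normr_gt0 subr_eq0.
have : (\sum_i `|u i ord0|) * (`|dot u x - c| / (2 * S)) <=
    S * (`|dot u x - c| / (2 * S)).
  by rewrite ler_wpM2r ?(ltW e0)// /S lerDr.
have -> : S * (`|dot u x - c| / (2 * S)) = `|dot u x - c| / 2.
  by field; rewrite gt_eqF.
lra.
Qed.

Lemma convex_boundary_null K : convex_cV K ->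
  borel_Rn n (closure K `\` K°) = 0.
Proof.
move=> cK; have [K0|K0] := pselect (K° !=set0).
  exact: convex_boundary_solid.
have mD : measurable (closure K `\` K°).
  by apply: measurableD; [exact: measurable_closure_cV|exact: measurable_interior_cV].
have [/eqP Ke|/set0P[x0 Kx0]] := boolP (K == set0).
  by rewrite Ke closure0 set0D measure0.
have [u u0 uK] := convex_flat cK Kx0 K0.
apply: (subset_measure0 mD _ _ (borel_Rn_hyperplane (dot u x0) u0)).
  by have := measurable_dot u measurableT (measurable_set1 (dot u x0)); rewrite setTI.
by move=> x [clx _]; exact: closure_hyperplane uK _ clx.
Qed.

End flat_convex_sets.

(** * Borel approximation of log-concave functions *)

Section log_concave_sandwich.
Context {R : realType} {n : nat} (t : 'cV[R]_n -> R).
Hypotheses (t0 : forall x, 0 <= t x) (ct : log_concave t).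

(** Weighted geometric means are at least the minimum. *)
Lemma log_concave_superlevel (c : R) : convex_cV [set x | c < t x].
Proof.
move=> x y l /andP[l0 l1] /= cx cy.
apply: lt_le_trans (ct x y _); last by rewrite l0.
have [c0|c0] := ltP c 0.
  by rewrite (lt_le_trans c0)// mulr_ge0// powR_ge0.
have [m [cm mx my]] : exists m, [/\ c < m, m <= t x & m <= t y].
  by have [xy|xy] := leP (t x) (t y); [exists (t x)|exists (t y); rewrite ltW].
have m0 : 0 < m by exact: le_lt_trans cm.
apply: (lt_le_trans cm).
have -> : m = m `^ l * m `^ (1 - l).
  have e : l + (1 - l) = 1 by rewrite addrC subrK.
  by rewrite -powRD e ?powRr1 ?oner_eq0// ltW.
have l1' : 0 <= 1 - l by rewrite subr_ge0.
by apply: ler_pM; rewrite ?powR_ge0// ge0_ler_powR// nnegrE// ltW.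
Qed.

Lemma log_concave_midpoint x y : t x * t y <= t (2^-1 *: (x + y)) ^+ 2.
Proof.
have h2 : 0 <= (2^-1 : R) <= 1 by apply/andP; split; lra.
have := ct x y h2; rewrite (_ : 1 - 2^-1 = 2^-1); last by field.
rewrite -scalerDr !powR12_sqrt// => h.
have := lerXn2r 2 _ _ h; rewrite !nnegrE mulr_ge0 ?sqrtr_ge0 ?t0// => /(_ isT isT).
by rewrite exprMn !sqr_sqrtr.
Qed.

(** The function [t] is the supremum of [max 0 q] times the indicator function of
the convex set [t > q], [q] rational.  Replacing these sets by their interiors
or by their closures gives the lower and the upper bound; the two differ only on
the boundaries, which are null sets. *)
Lemma log_concave_borel_sandwich : exists (f h : 'cV[R]_n -> \bar R) N,
  [/\ measurable_fun setT f, measurable_fun setT h, measurable N,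
      borel_Rn n N = 0 &
      [/\ forall x, (0 <= f x <= (t x)%:E)%E, forall x, ((t x)%:E <= h x)%E &
          forall x, ~ N x -> f x = (t x)%:E /\ h x = (t x)%:E]].
Proof.
pose A (q : rat) := [set x | ratr q < t x].
pose cut (B : rat -> set 'cV[R]_n) k x : \bar R :=
  if unpickle k is Some q then ((Num.max 0 (ratr q) : R) * \1_(B q) x)%:E else 0%E.
have mcut B k : (forall q, measurable (B q)) -> measurable_fun setT (cut B k).
  move=> mB; rewrite /cut; case: unpickle => [q|]; last exact: measurable_cst.
  by apply/measurable_EFinP; apply: measurable_funM => //; exact: measurable_indic.
have cut0 B k x : (0 <= cut B k x)%E.
  rewrite /cut; case: unpickle => // q; rewrite lee_fin mulr_ge0//.
  by rewrite le_max lexx.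
pose S B x := esups (fun k => cut B k x) 0%N.
have cutS B k x : (cut B k x <= S B x)%E.
  by apply: ereal_sup_ubound => /=; exists k.
have S0 B x : (0 <= S B x)%E by exact: le_trans (cutS B 0%N x).
pose N := \bigcup_k (if unpickle k is Some q then closure (A q) `\` (A q)° else set0).
have mi q : measurable (A q)° by exact: measurable_interior_cV.
have mc q : measurable (closure (A q)) by exact: measurable_closure_cV.
have mN k : measurable (if @unpickle rat k is Some q then closure (A q) `\` (A q)° else set0).
  by case: unpickle => // q; exact: measurableD.
have SL x : (S (fun q => (A q)°) x <= (t x)%:E)%E.
  apply: ge_ereal_sup => _ [k _ <-]; rewrite /cut.
  case: unpickle => [q|]; last by rewrite lee_fin.
  rewrite lee_fin indicE; have [xA|xA] := pselect ((A q)° x).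
    by rewrite mem_set// mulr1 ge_max t0/= ltW//; exact: interior_subset xA.
  by rewrite memNset// mulr0.
have SU x : ((t x)%:E <= S (fun q => closure (A q)) x)%E.
  rewrite leNgt; apply/negP => lt.
  have := S0 (fun q => closure (A q)) x.
  case E : (S _ x) lt => [r| |//]; last by rewrite ltNge leey.
  rewrite lte_fin lee_fin => rt r0.
  have [q /[!in_itv]/= /andP[rq qt]] := rat_in_itvoo rt.
  have := cutS (fun q => closure (A q)) (pickle q) x.
  rewrite E /cut pickleK indicE mem_set; last exact: subset_closure.
  rewrite mulr1 lee_fin leNgt => /negP; apply.
  by rewrite lt_max rq orbT.
exists (S (fun q => (A q)°)), (S (fun q => closure (A q))), N; split.
- by apply: measurable_fun_esups => k; exact: mcut.
- by apply: measurable_fun_esups => k; exact: mcut.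
- exact: bigcupT_measurable.
- apply: measure_negligible; first exact: bigcupT_measurable.
  apply: negligible_bigcup => k.
  exists (if @unpickle rat k is Some q then closure (A q) `\` (A q)° else set0).
  split => //; case: unpickle => [q|]; last exact: measure0.
  exact/convex_boundary_null/log_concave_superlevel.
split => // [x|x Nx]; first by rewrite S0 SL.
have E : S (fun q => closure (A q)) x = S (fun q => (A q)°) x.
  rewrite /S (_ : (fun k => cut (fun q => closure (A q)) k x) =
    (fun k => cut (fun q => (A q)°) k x))//.
  apply/funext => k; rewrite /cut; case Ek : unpickle => [q|//].
  congr ((_ * _)%:E); rewrite !indicE; congr (_%:R); congr nat_of_bool.
  apply/idP/idP; rewrite !inE => h; last first.
    by apply: subset_closure; exact: interior_subset.
  by apply: contrapT => h'; apply: Nx; exists k => //; rewrite Ek; split.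
have tE : S (fun q => (A q)°) x = (t x)%:E.
  by apply/eqP; rewrite eq_le SL/= -E; exact: SU.
by rewrite E tE.
Qed.

End log_concave_sandwich.

(** * Gaussian weights *)

Section gaussian_weights.
Context {R : realType}.
Local Open Scope ereal_scope.

Lemma integral_gauss_line (d : R) : (0 < d)%R ->
  \int[lebesgue_measure]_x (expR (- (d * x ^+ 2)))%:E < +oo.
Proof.
move=> d0; pose c := Num.sqrt d.
have c0 : (0 < c)%R by rewrite sqrtr_gt0.
have mg : measurable_fun setT (EFin \o @gauss_fun R).
  by apply/measurable_EFinP; exact: measurable_gauss_fun.
have g0 x : 0 <= (EFin \o @gauss_fun R) x by rewrite lee_fin gauss_fun_ge0.
have := lebesgue_integral_affine 0 c0 mg g0.
rewrite integralT_gauss -EFinM => E.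
rewrite (_ : \int[_]_x _ = (c^-1 * Num.sqrt pi)%:E) ?ltry// -E.
apply: eq_integral => x _; congr EFin.
by rewrite /gauss_fun addr0 exprMn sqr_sqrtr// ltW.
Qed.

Let measurable_gauss_dot n (d : R) :
  measurable_fun setT (fun x : 'cV[R]_n => (expR (- (d * dot x x)))%:E).
Proof.
apply/measurable_EFinP; apply: measurableT_comp => //.
apply: measurableT_comp => //; apply: measurable_funM => //.
rewrite (_ : (fun x => dot x x) = qform (1%:M : 'M[R]_n)).
  exact: measurable_qform.
by apply/funext => x; rewrite qformE mul1mx.
Qed.

Lemma integral_gauss_Rn n (d : R) : (0 < d)%R ->
  \int[borel_Rn n]_x (expR (- (d * dot x x)))%:E < +oo.
Proof.
move=> d0.
have m k : measurable_fun setT (fun x : 'cV[R]_k => (expR (- (d * dot x x)))%:E).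
  exact: measurable_gauss_dot.
elim: n => [|n IH].
  rewrite integral_dirac//; last exact: m.
  by rewrite diracT mul1e ltry.
have e0 k x : 0 <= (expR (- (d * @dot R k x x)))%:E by rewrite lee_fin expR_ge0.
rewrite (ge0_integral_borel_RnS (m n.+1) (e0 n.+1)).
pose I := \int[borel_Rn n]_x (expR (- (d * dot x x)))%:E.
have I0 : 0 <= I by apply: integral_ge0 => x _; rewrite lee_fin expR_ge0.
have mg : measurable_fun (setT : set (measurableTypeR R)) (fun a : R => (expR (- (d * a ^+ 2)))%:E).
  apply/measurable_EFinP; apply: measurableT_comp => //.
  by apply: measurableT_comp => //; apply: measurable_funM => //; exact: measurable_funX.
rewrite (_ : \int[lebesgue_measure]_a _ =
    \int[lebesgue_measure]_a (I * (expR (- (d * a ^+ 2)))%:E)); last first.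
  apply: eq_integral => a _.
  have ea0 : 0 <= (expR (- (d * a ^+ 2)))%:E by rewrite lee_fin expR_ge0.
  rewrite muleC -(ge0_integralZl _ measurableT (m n) (fun x _ => e0 n x) ea0).
  apply: eq_integral => x _; rewrite dot_cons_cV -EFinM -expRD; congr (expR _)%:E.
  by rewrite mulrDr opprD expr2.
have ea0 a : (setT : set R) a -> 0 <= (expR (- (d * a ^+ 2)))%:E.
  by rewrite lee_fin expR_ge0.
rewrite (ge0_integralZl _ measurableT mg ea0 I0).
apply: lte_mul_pinfty => //; last exact: integral_gauss_line.
by rewrite ge0_fin_numE.
Qed.

Context {n : nat} (A : 'M[R]_n) (pA : posdefmx A).

Definition gauss_weight (h x : 'cV[R]_n) : R :=
  expR (- (1 / 2) * qform A x + dot h x).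

Lemma gauss_weight_gt0 h x : (0 < gauss_weight h x)%R.
Proof. exact: expR_gt0. Qed.

Lemma gauss_weight_ge0 h x : (0 <= gauss_weight h x)%R.
Proof. exact: expR_ge0. Qed.

Lemma measurable_gauss_weight h : measurable_fun setT (gauss_weight h).
Proof.
apply: measurableT_comp => //; apply: measurable_funD; last exact: measurable_dot.
by apply: measurable_funM => //; exact: measurable_qform.
Qed.

Lemma expR_gauss_weight h u x :
  (expR (dot u x) * gauss_weight h x = gauss_weight (h + u) x)%R.
Proof. by rewrite /gauss_weight -expRD dotDl; congr expR; ring. Qed.

(** Completing the square. *)
Lemma gauss_weight_shift h u x : (gauss_weight (h + u) x =
  expR (qform (invmx A) u / 2 + dot h (invmx A *m u)) *
  gauss_weight h (x - invmx A *m u))%R.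
Proof.
have Au := posdef_unitmx pA; case: (pA) => As _.
rewrite /gauss_weight -expRD qformB// -qform_invmx// mulKVmx//.
by rewrite dotBr dotDl (dotC x u); congr expR; field.
Qed.

Lemma gauss_weight_midpoint h x y :
  (gauss_weight h x * gauss_weight h y <= gauss_weight h (2^-1 *: (x + y)) ^+ 2)%R.
Proof.
case: (pA) => As _; have := posdef_ge0 (x - y) pA.
rewrite /gauss_weight -expRD expr2 -expRD ler_expR.
rewrite qformZ qformB// qformD// dotZr dotDr; move: (qform A x) (qform A y) => a b.
move: (dot x (A *m y)) (dot h x) (dot h y) => c e f; lra.
Qed.

(** The form of [A] dominates a multiple of the Euclidean one, by the bound
[x_i ^ 2 <= (A^-1)_ii Q x] for every coordinate; the linear term is
absorbed by half of the exponent [- Q x / 2]. *)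
Lemma gauss_weight_le h : exists K d : R, (0 < d)%R /\
  forall x, (gauss_weight h x <= expR K * expR (- (d * dot x x)))%R.
Proof.
pose T := (1 + \sum_i invmx A i i)%R.
have T0 : (0 < T)%R.
  rewrite ltr_wpDr// sumr_ge0// => i _.
  have := posdef_ge0 (delta_mx i ord0) (posdef_invmx pA).
  by rewrite qformE dot_delta -colE mxE.
exists (qform (invmx A) h), (4 * T)^-1%R; split; first by rewrite invr_gt0 mulr_gt0.
move=> x; rewrite /gauss_weight -expRD ler_expR.
have h1 := posdef_young (2 *: h) x pA; rewrite dotZl qformZ in h1.
have h2 : (dot x x <= T * qform A x)%R.
  rewrite dotE; apply: (@le_trans _ _ (\sum_i invmx A i i * qform A x)%R).
    by apply: ler_sum => i _; rewrite -expr2; exact: posdef_coord_le.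
  by rewrite -mulr_suml /T mulrDl mul1r lerDr posdef_ge0.
have h3 : ((4 * T)^-1 * dot x x <= qform A x / 4)%R.
  rewrite invfM -mulrA mulrC ler_pM2r ?invr_gt0// mulrC ler_pdivrMr// mulrC//.
lra.
Qed.

Lemma integral_gauss_weight h : \int[borel_Rn n]_x (gauss_weight h x)%:E < +oo.
Proof.
have [K [d [d0 le]]] := gauss_weight_le h.
apply: (@le_lt_trans _ _ ((expR K)%:E * \int[borel_Rn n]_x (expR (- (d * dot x x)))%:E)).
  have m := @measurable_gauss_dot n d.
  have e0 (x : 'cV[R]_n) : setT x -> 0 <= (expR (- (d * dot x x)))%:E.
    by rewrite lee_fin expR_ge0.
  have eK0 : 0 <= (expR K)%:E by rewrite lee_fin expR_ge0.
  rewrite -(ge0_integralZl _ measurableT m e0 eK0).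
  apply: ge0_le_integral => //.
  - by move=> x _; rewrite lee_fin gauss_weight_ge0.
  - by apply/measurable_EFinP; exact: measurable_gauss_weight.
  - exact: measurable_funeM.
  - by move=> x _; rewrite -EFinM lee_fin.
apply: lte_mul_pinfty => //.
exact: integral_gauss_Rn.
Qed.

End gaussian_weights.

(** * Covariance matrices of densities with exponential moments *)

Lemma Rintegral_sum d (T : measurableType d) (R : realType)
    (mu : {measure set T -> \bar R}) (I : Type) (s : seq I) (f : I -> T -> R) :
  (forall i, mu.-integrable setT (EFin \o f i)) ->
  \int[mu]_x (\sum_(i <- s) f i x) = \sum_(i <- s) \int[mu]_x f i x.
Proof.
move=> fi; elim: s => [|i s IH].
  rewrite big_nil -[RHS](mul0r (fine (mu setT))) -Rintegral_cst//.
  by apply: eq_Rintegral => x _; rewrite big_nil.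
rewrite big_cons -IH -RintegralD//.
  by apply: eq_Rintegral => x _; rewrite big_cons.
have := integrable_sum measurableT s (fun j (_ : xpredT j) => fi j).
by congr integrable; apply/funext => x /=; rewrite -sumEFin.
Qed.

Section densities_with_exponential_moments.
Context {R : realType} {n : nat}.
Local Notation leb := (@lebesgue_Rn R n).
Variable p : 'cV[R]_n -> R.
Hypotheses (mp : measurable_fun (setT : set (caratheodory_type ((@borel_Rn R n)^*)%mu)) p)
  (p0 : forall x, 0 <= p x)
  (ip : forall u : 'cV[R]_n, leb.-integrable setT (fun x => (expR (dot u x) * p x)%:E))
  (p1 : \int[leb]_x p x = 1).

Let mdot u : measurable_fun (setT : set (caratheodory_type ((@borel_Rn R n)^*)%mu)) (dot u).
Proof. exact: (borel_lebesgue_measurable_fun (measurable_dot u)). Qed.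

Let ips u (s : R) : leb.-integrable setT (fun x => (expR (s * dot u x) * p x)%:E).
Proof. by under eq_fun do rewrite -dotZl; exact: ip. Qed.

Let ipp : leb.-integrable setT (EFin \o p).
Proof. have := integrable_density (ips 0). exact. Qed.

Let i1 u : leb.-integrable setT (fun x => (dot u x * p x)%:E).
Proof.
have := integrable_moment (mdot u) mp p0 (ips u) (isT : (1 <= 2)%N).
by under eq_fun do rewrite expr1.
Qed.

Let i2 u v : leb.-integrable setT (fun x => (dot u x * dot v x * p x)%:E).
Proof.
have h w := integrable_moment (mdot w) mp p0 (ips w) (isT : (2 <= 2)%N).
have H := integrableD measurableT (h u) (h v).
refine (le_integrable measurableT _ _ H).
- apply/measurable_EFinP.
  exact: (measurable_funM (measurable_funM (mdot u) (mdot v)) mp).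
- move=> x _; rewrite -EFinD /= lee_fin -mulrDl !normrM (ger0_norm (p0 x)) ler_wpM2r//.
  rewrite -normrM [leRHS]ger0_norm ?addr_ge0 ?sqr_ge0// ler_norml.
  have := sqr_ge0 (dot u x - dot v x); have := sqr_ge0 (dot u x + dot v x).
  by move=> ? ?; apply/andP; split; nra.
Qed.

Lemma density_second_moments : has_second_moments p.
Proof.
split=> [j|j k].
  have := i1 (delta_mx j ord0).
  by under eq_fun do rewrite dot_delta.
have := i2 (delta_mx j ord0) (delta_mx k ord0).
by under eq_fun do rewrite !dot_delta.
Qed.

Lemma dot_mean u : dot u (mean p) = \int[leb]_x (dot u x * p x).
Proof.
rewrite dotE.
transitivity (\int[leb]_x (\sum_j u j ord0 * (x j ord0 * p x))).
  rewrite Rintegral_sum => [|j]; last first.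
    by have := integrableZl measurableT (u j ord0) (density_second_moments.1 j).
  apply: eq_bigr => j _; rewrite RintegralZl ?mxE//.
  exact: (density_second_moments.1 j).
apply: eq_Rintegral => x _; rewrite dotE mulr_suml.
by apply: eq_bigr => j _; rewrite mulrA.
Qed.

Let m := mean p.

Let icov u v : leb.-integrable setT
  (fun x => ((dot u x - dot u m) * (dot v x - dot v m) * p x)%:E).
Proof.
have : leb.-integrable setT (fun x => ((dot u x * dot v x * p x)%:E
    - ((dot v m)%:E * (dot u x * p x)%:E) - ((dot u m)%:E * (dot v x * p x)%:E)
    + ((dot u m * dot v m)%:E * (p x)%:E))%E).
  apply: integrableD => //; last exact: integrableZl.
  apply: integrableB => //; last exact: integrableZl.
  by apply: integrableB => //; exact: integrableZl.
apply: eq_integrable => // x _; rewrite -!EFinM -!EFinB -EFinD; congr EFin; ring.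
Qed.

Lemma covmx_entry j k : covmx p j k = \int[leb]_x
  ((dot (delta_mx j ord0) x - dot (delta_mx j ord0) m) *
   (dot (delta_mx k ord0) x - dot (delta_mx k ord0) m) * p x).
Proof. by rewrite mxE; apply: eq_Rintegral => x _; rewrite !dot_delta. Qed.

Lemma covmx_sym : (covmx p)^T = covmx p.
Proof.
apply/matrixP => j k; rewrite [LHS]mxE !covmx_entry.
by apply: eq_Rintegral => x _ /=; congr (_ * _); rewrite mulrC.
Qed.

Lemma qform_covmx u : qform (covmx p) u =
  \int[leb]_x ((dot u x - dot u m) ^+ 2 * p x).
Proof.
have dE y : dot u y = \sum_j u j ord0 * dot (delta_mx j ord0) y.
  by rewrite dotE; apply: eq_bigr => j _; rewrite dot_delta.
rewrite qformE dotE.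
transitivity (\sum_j \int[leb]_x (u j ord0 *
    ((dot (delta_mx j ord0) x - dot (delta_mx j ord0) m) * (dot u x - dot u m) * p x))).
  apply: eq_bigr => j _; rewrite RintegralZl//; last exact: icov.
  congr (_ * _); rewrite mxE.
  transitivity (\sum_k \int[leb]_x (u k ord0 *
    ((dot (delta_mx j ord0) x - dot (delta_mx j ord0) m) *
     (dot (delta_mx k ord0) x - dot (delta_mx k ord0) m) * p x))).
    apply: eq_bigr => k _; rewrite covmx_entry mulrC RintegralZl//; exact: icov.
  rewrite -Rintegral_sum => [|k]; last first.
    by have := integrableZl measurableT (u k ord0)
      (icov (delta_mx j ord0) (delta_mx k ord0)).
  apply: eq_Rintegral => x _ /=; rewrite (dE x) (dE m) -sumrB mulr_sumr mulr_suml.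
  by apply: eq_bigr => k _; ring.
rewrite -Rintegral_sum => [|j]; last first.
  by have := integrableZl measurableT (u j ord0) (icov (delta_mx j ord0) u).
apply: eq_Rintegral => x _ /=.
set D := dot u x - dot u m.
have E : \sum_j u j ord0 * (dot (delta_mx j ord0) x - dot (delta_mx j ord0) m) = D.
  by rewrite /D (dE x) (dE m) -sumrB; apply: eq_bigr => j _; ring.
transitivity ((\sum_j u j ord0 * (dot (delta_mx j ord0) x - dot (delta_mx j ord0) m))
  * D * p x); last by rewrite E expr2.
rewrite !mulr_suml.
by apply: eq_bigr => j _; ring.
Qed.

(** If the variance of [u^T x] vanished, [p] would be zero off a hyperplane, that
is, almost everywhere. *)
Lemma posdef_covmx : posdefmx (covmx p).
Proof.
split; first exact: covmx_sym.
move=> u u0; rewrite qform_covmx lt_def Rintegral_ge0 ?andbT; last first.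
  by move=> x _; rewrite mulr_ge0 ?sqr_ge0.
apply/eqP => V0.
pose f x := ((dot u x - dot u m) ^+ 2 * p x)%:E.
have f0 x : (0 <= f x)%E by rewrite lee_fin mulr_ge0 ?sqr_ge0.
have If : leb.-integrable setT f by have := icov u u; under eq_fun do rewrite -expr2.
have E0 : (\int[leb]_x `|f x| = 0)%E.
  under eq_integral do rewrite gee0_abs//.
  by rewrite -[LHS]fineK ?integrable_fin_num//; congr EFin.
have /ae_eq_integral_abs := E0.
move=> /(_ measurableT (measurable_int _ If)) aef.
pose H := [set x | dot u x = dot u m].
have mH : measurable H.
  by have := measurable_dot u measurableT (measurable_set1 (dot u m)); rewrite setTI.
have aep : ae_eq leb setT (EFin \o p) (cst 0%E).
  case: aef => N [mN N0 fN].
  have mH' : measurable (H : set (caratheodory_type ((@borel_Rn R n)^*)%mu)).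
    exact: borel_lebesgue_measurable.
  exists (N `|` H); split.
  - exact: measurableU.
  - rewrite measureU0//; apply: etrans (lebesgue_RnE mH) _.
    exact: borel_Rn_hyperplane.
  - move=> x px; have [Hx|Hx] := pselect (H x); [by right|left].
    apply: fN => /= fx; apply: px => _ /=.
    have [] := fx I; move=> /eqP; rewrite mulf_eq0 sqrf_eq0 subr_eq0.
    by case/orP => /eqP // ->.
have mEp := measurable_int _ ipp.
have E := ge0_ae_eq_integral measurableT mEp (measurable_cst 0%E)
  (fun x _ => p0 x : (0 <= (p x)%:E)%E) (fun _ _ => lexx _) aep.
move: p1; rewrite /Rintegral; have -> : (\int[leb]_x (p x)%:E = 0)%E.
  by apply: etrans E _; exact: integral0.
by move=> /esym/eqP; rewrite oner_eq0.
Qed.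

Let a u (s : R) := \int[leb]_x (expR (s * dot u x) * p x).

Let centered u s : \int[leb]_x (expR (s * (dot u x - dot u m)) * p x) =
  expR (- (s * dot u m)) * a u s.
Proof.
rewrite -RintegralZl//; last exact: ips.
apply: eq_Rintegral => x _ /=.
by rewrite mulrA -expRD; congr (expR _ * _); ring.
Qed.

Let centered_integrable u (s : R) :
  leb.-integrable setT (fun x => (expR (s * (dot u x - dot u m)) * p x)%:E).
Proof.
have := integrableZl measurableT (expR (- (s * dot u m))) (ips u s).
apply: eq_integrable => // x _; rewrite -EFinM; congr EFin.
by rewrite mulrA -expRD; congr (expR _ * _); ring.
Qed.

Let measurable_centered u :
  measurable_fun (setT : set (caratheodory_type ((@borel_Rn R n)^*)%mu))
    (fun x => dot u x - dot u m).
Proof. by apply: measurable_funB => //; exact: mdot. Qed.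

Let mean_centered u : \int[leb]_x ((dot u x - dot u m) * p x) = 0.
Proof.
have im : leb.-integrable setT (EFin \o (fun x => dot u m * p x)).
  by have := integrableZl measurableT (dot u m) ipp.
transitivity (\int[leb]_x (dot u x * p x - dot u m * p x)).
  by apply: eq_Rintegral => x _ /=; rewrite mulrBl.
rewrite RintegralB//; last exact: i1.
by rewrite RintegralZl// -dot_mean p1 mulr1 subrr.
Qed.

Let centered_prod u s : \int[leb]_x (expR (s * (dot u x - dot u m)) * p x) *
  \int[leb]_x (expR (- s * (dot u x - dot u m)) * p x) = a u s * a u (- s).
Proof.
by rewrite !centered mulrACA -expRD (_ : _ + _ = 0) ?expR0 ?mul1r//; ring.
Qed.

Lemma qform_covmx_le u (c : R) :
  (forall s, a u s * a u (- s) <= expR (c * s ^+ 2)) -> qform (covmx p) u <= c.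
Proof.
move=> h; rewrite qform_covmx.
apply: (centered_variance_le (measurable_centered u) mp p0 (centered_integrable u) p1
  (mean_centered u)) => s.
by rewrite centered_prod.
Qed.

Lemma qform_covmx_ge u (c : R) :
  (forall s, expR (c * s ^+ 2) <= a u s * a u (- s)) -> c <= qform (covmx p) u.
Proof.
move=> h; rewrite qform_covmx.
apply: (centered_variance_ge (measurable_centered u) mp p0 (centered_integrable u) p1
  (mean_centered u)) => s.
by rewrite centered_prod.
Qed.

End densities_with_exponential_moments.

(** * Log-concave perturbations of a Gaussian *)

Section log_concave_times_gaussian.
Context {R : realType} {n : nat}.
Local Notation leb := (@lebesgue_Rn R n).
Local Notation measurableL :=
  (measurable_fun (setT : set (caratheodory_type ((@borel_Rn R n)^*)%mu))).
Variables (A : 'M[R]_n) (h : 'cV[R]_n) (t : 'cV[R]_n -> R) (M : R).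
Hypotheses (pA : posdefmx A) (t0 : forall x, 0 <= t x) (ct : log_concave t)
  (tM : forall x, t x <= M).

Local Notation G := (gauss_weight A).

Definition tilt x := t x * G h x.

Definition shifted_mass v := \int[leb]_x (t x * G h (x - v)).

Lemma shifted_mass0 : shifted_mass 0 = mass tilt.
Proof. by apply: eq_Rintegral => x _ /=; rewrite subr0. Qed.

Lemma tilt_ge0 x : 0 <= tilt x.
Proof. exact: mulr_ge0 (t0 x) (gauss_weight_ge0 _ _ _). Qed.

Lemma measurable_log_concave : measurableL t.
Proof.
have [f [k [N [mf mk mN N0 [_ _ fk]]]]] := log_concave_borel_sandwich t0 ct.
apply/measurable_EFinP.
by apply: (ae_borel_lebesgue_measurable_fun mf mN N0) => x /fk[].
Qed.

Let mG u : measurableL (G u).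
Proof. exact: (borel_lebesgue_measurable_fun (measurable_gauss_weight A u)). Qed.

Let mEG u : measurable_fun setT (EFin \o G u).
Proof. by apply/measurable_EFinP; exact: measurable_gauss_weight. Qed.

Let G0 u x : (0 <= (EFin \o G u) x)%E.
Proof. rewrite lee_fin; exact: gauss_weight_ge0. Qed.

Let iG u : leb.-integrable setT (EFin \o G u).
Proof.
apply/integrableP; split; first exact/measurable_EFinP.
under eq_integral do rewrite gee0_abs ?G0//.
rewrite (ge0_integral_lebesgue_Rn (mEG u) (G0 u)); exact: integral_gauss_weight.
Qed.

Let itG u : leb.-integrable setT (EFin \o (fun x => t x * G u x)).
Proof.
have H := integrableZl measurableT M (iG u).
refine (le_integrable measurableT _ _ H).
  apply/measurable_EFinP.
  exact: (measurable_funM measurable_log_concave (mG u)).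
move=> x _ /=; rewrite lee_fin !normrM ler_wpM2r//.
by rewrite (ger0_norm (t0 x)) (le_trans (tM x))// ler_norm.
Qed.

Lemma integrable_tilt : leb.-integrable setT (EFin \o tilt).
Proof. exact: itG. Qed.

Lemma tilt_exp_integrable u :
  leb.-integrable setT (fun x => (expR (dot u x) * tilt x)%:E).
Proof.
have := itG (h + u); apply: eq_integrable => // x _ /=; congr EFin.
by rewrite -expR_gauss_weight /tilt mulrCA.
Qed.

Let integrable_shift v : leb.-integrable setT (EFin \o (fun x => t x * G h (x - v))).
Proof.
have Au := posdef_unitmx pA.
pose e := expR (qform (invmx A) (A *m v) / 2 + dot h (invmx A *m (A *m v))).
have := integrableZl measurableT e^-1 (itG (h + A *m v)).
apply: eq_integrable => // x _ /=; congr EFin.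
rewrite /e gauss_weight_shift// !mulKmx// mulrCA; congr (_ * _).
by rewrite mulrA mulVf ?mul1r// gt_eqF// expR_gt0.
Qed.

(** Completing the square turns the exponential weight into a translation. *)
Lemma tilt_mgf u s : \int[leb]_x (expR (s * dot u x) * tilt x) =
  expR (s ^+ 2 * qform (invmx A) u / 2 + s * dot h (invmx A *m u)) *
  shifted_mass (s *: (invmx A *m u)).
Proof.
have := RintegralZl (expR (s ^+ 2 * qform (invmx A) u / 2 + s * dot h (invmx A *m u)))
  measurableT (integrable_shift (s *: (invmx A *m u))).
move=> <-; apply: eq_Rintegral => x _ /=.
rewrite /tilt -dotZl mulrCA expR_gauss_weight.
by rewrite gauss_weight_shift// qformZ -scalemxAr dotZr mulrCA.
Qed.

Let measurable_shift u v : measurable_fun setT (fun x : 'cV[R]_n => (EFin \o G u) (x - v)).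
Proof.
apply: (measurableT_comp (mEG u)).
by have := measurable_affine_cV 1 (- v); under eq_fun do rewrite scale1r.
Qed.

(** The midpoint of [x] and [y] is also that of [x - v] and [y + v], hence the
Prekopa-Leindler inequality applies to the integrands on both sides.  To have
Borel functions, [t] is replaced by a lower bound on the left and by an upper
bound on the right. *)
Lemma shifted_mass_log_concave v :
  shifted_mass v * shifted_mass (- v) <= mass tilt ^+ 2.
Proof.
have [f [k [N [mf mk mN N0 [ft tk fk]]]]] := log_concave_borel_sandwich t0 ct.
have f0 x : (0 <= f x)%E by have /andP[] := ft x.
have k0 x : (0 <= k x)%E by apply: le_trans (tk x); rewrite lee_fin.
have tG0 x w : 0 <= t x * G h (x - w).
  exact: mulr_ge0 (t0 x) (gauss_weight_ge0 _ _ _).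
have mM g w : measurable_fun setT g ->
    measurable_fun setT (fun x : 'cV[R]_n => g x * (EFin \o G h) (x - w)%R)%E.
  by move=> mg; exact: (emeasurable_funM mg (measurable_shift h w)).
have M0 g w (x : 'cV[R]_n) : (forall x, 0 <= g x)%E ->
    (0 <= g x * (EFin \o G h) (x - w)%R)%E.
  by move=> g0; exact: mule_ge0 (g0 x) (G0 h _).
have tb g w : measurable_fun setT g -> (forall x, 0 <= g x)%E ->
    (forall x, ~ N x -> g x = (t x)%:E) ->
    (\int[borel_Rn n]_x (g x * (EFin \o G h) (x - w)%R))%E = (shifted_mass w)%:E.
  move=> mg g0 gt.
  have mgG := mM g w mg.
  have gG0 x := M0 g w x g0.
  rewrite -(ge0_integral_lebesgue_Rn mgG gG0) /shifted_mass /Rintegral fineK; last first.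
    exact: (integrable_fin_num measurableT (integrable_shift w)).
  have mJ := measurable_int _ (integrable_shift w).
  apply: (ge0_ae_eq_integral measurableT _ mJ).
  - exact: borel_lebesgue_measurable_fun.
  - by move=> x _; exact: gG0.
  - by move=> x _; rewrite lee_fin; exact: tG0.
  - exists N; split.
    + exact: borel_lebesgue_measurable.
    + by apply: etrans (lebesgue_RnE mN) _.
    + move=> x /= ne; apply: contrapT => Nx; apply: ne => _.
      by rewrite gt// EFinM.
have fN x : ~ N x -> f x = (t x)%:E by move=> /fk[].
have kN x : ~ N x -> k x = (t x)%:E by move=> /fk[].
have E1 := tb f v mf f0 fN; have E2 := tb f (- v) mf f0 fN.
have E3 := tb k 0 mk k0 kN.
have le1 w x : (f x * (EFin \o G h) (x - w)%R <= (t x * G h (x - w))%:E)%E.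
  by rewrite EFinM lee_wpmul2r ?G0//; have /andP[] := ft x.
have le2 x : ((t x * G h (x - 0))%:E <= k x * (EFin \o G h) (x - 0)%R)%E.
  by rewrite EFinM lee_wpmul2r ?G0.
have PL x y : (f x * (EFin \o G h) (x - v)%R * (f y * (EFin \o G h) (y - - v)%R) <=
    k (2^-1 *: (x + y))%R * (EFin \o G h) (2^-1 *: (x + y) - 0)%R *
    (k (2^-1 *: (x + y))%R * (EFin \o G h) (2^-1 *: (x + y) - 0)%R))%E.
  set z := 2^-1 *: (x + y).
  apply: (@le_trans _ _ ((t x * G h (x - v))%:E * (t y * G h (y - - v))%:E)%E).
    by apply: lee_pmul; [exact: M0|exact: M0|exact: le1|exact: le1].
  apply: (@le_trans _ _ ((t z * G h (z - 0))%:E * (t z * G h (z - 0))%:E)%E); last first.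
    by apply: lee_pmul; rewrite ?lee_fin; [exact: tG0|exact: tG0|exact: le2|exact: le2].
  rewrite -!EFinM lee_fin mulrACA (mulrACA (t z)) -!expr2 subr0.
  apply: ler_pM.
  - exact: mulr_ge0 (t0 x) (t0 y).
  - exact: mulr_ge0 (gauss_weight_ge0 _ _ _) (gauss_weight_ge0 _ _ _).
  - exact: log_concave_midpoint.
  - apply: (le_trans (gauss_weight_midpoint pA _ _ _)).
    by rewrite opprK addrACA addNr addr0.
have := prekopa_leindler (mM f v mf) (mM f (- v) mf) (mM k 0 mk)
  (fun x => M0 f v x f0) (fun x => M0 f (- v) x f0) (fun x => M0 k 0 x k0) PL.
by rewrite E1 E2 E3 shifted_mass0 -!EFinM lee_fin expr2.
Qed.

(** Translation invariance of the Lebesgue measure. *)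
Lemma shifted_mass_cst v : (forall x, t x = 1) -> shifted_mass v = mass tilt.
Proof.
move=> t1; rewrite -shifted_mass0.
suff JI w : shifted_mass w = fine (\int[borel_Rn n]_x (EFin \o G h) x)%E.
  by rewrite !JI.
rewrite -(integral_borel_Rn_shift (- w) (mEG h) (G0 h)).
rewrite -(ge0_integral_lebesgue_Rn (measurable_shift h w) (fun x => G0 h _)).
by congr fine; apply: eq_integral => x _; rewrite t1 mul1r.
Qed.

End log_concave_times_gaussian.

Section covariance_of_tilt.
Context {R : realType} {n : nat}.
Local Notation leb := (@lebesgue_Rn R n).
Local Notation measurableL :=
  (measurable_fun (setT : set (caratheodory_type ((@borel_Rn R n)^*)%mu))).
Variables (A : 'M[R]_n) (h : 'cV[R]_n) (t : 'cV[R]_n -> R) (M : R).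
Hypotheses (pA : posdefmx A) (t0 : forall x, 0 <= t x) (ct : log_concave t)
  (tM : forall x, t x <= M).

(** Otherwise [t] would vanish almost everywhere, Gaussian weights being
positive. *)
Lemma normalizable_tilt :
  (0 < leb [set x | (t x != 0)%R])%E -> normalizable (tilt A h t).
Proof.
move=> ts; have it := integrable_tilt h pA t0 ct tM.
split; first exact: it.
rewrite lt_def Rintegral_ge0 ?andbT; last by move=> x _; exact: tilt_ge0.
apply/eqP => m0.
have E0 : (\int[leb]_x `|(EFin \o tilt A h t) x| = 0)%E.
  under eq_integral do rewrite gee0_abs ?lee_fin ?tilt_ge0//.
  rewrite -[LHS]fineK; first by congr EFin.
  exact: (integrable_fin_num measurableT it).
have /ae_eq_integral_abs := E0.
move=> /(_ measurableT (measurable_int _ it)) [N [mN N0 fN]].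
suff : (leb [set x | (t x != 0)%R] <= leb N)%E by rewrite N0 leNgt ts.
apply: le_measure; rewrite ?inE//.
  rewrite (_ : mkset _ = ~` (setT `&` t @^-1` [set 0])).
    by apply: measurableC; exact: (measurable_log_concave t0 ct).
  by rewrite setTI; apply/seteqP; split => x /= /eqP.
move=> x /= tx; apply: fN => /= hx; have [] := hx I.
by move=> /eqP; rewrite mulf_eq0 (negbTE tx)/= gt_eqF// gauss_weight_gt0.
Qed.

Hypothesis mass_gt0 : 0 < mass (tilt A h t).

Let m := mass (tilt A h t).
Let p := normalized (tilt A h t).

Let mp : measurableL p.
Proof.
have mG := borel_lebesgue_measurable_fun (measurable_gauss_weight A h).
exact: (measurable_funM (measurable_funM (measurable_log_concave t0 ct) mG)
  (measurable_cst m^-1)).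
Qed.

Let p0 x : 0 <= p x.
Proof. exact: divr_ge0 (tilt_ge0 A h t0 x) (ltW mass_gt0). Qed.

Let ip u : leb.-integrable setT (fun x => (expR (dot u x) * p x)%:E).
Proof.
have := integrableZl measurableT m^-1 (tilt_exp_integrable h pA t0 ct tM u).
by apply: eq_integrable => // x _ /=; congr EFin; rewrite /p /normalized -/m; ring.
Qed.

Let p1 : \int[leb]_x p x = 1.
Proof.
rewrite RintegralZr//; last exact: (integrable_tilt h pA t0 ct tM).
by rewrite -/(mass _) divff// gt_eqF.
Qed.

Lemma tilt_second_moments : has_second_moments p.
Proof. exact: density_second_moments mp p0 ip. Qed.

Lemma posdef_covmx_tilt : posdefmx (covmx p).
Proof. exact: posdef_covmx mp p0 ip p1. Qed.

Let mgf_prod u s :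
  \int[leb]_x (expR (s * dot u x) * p x) *
  \int[leb]_x (expR (- s * dot u x) * p x) =
  expR (qform (invmx A) u * s ^+ 2) *
  (shifted_mass A h t (s *: (invmx A *m u)) *
   shifted_mass A h t (- (s *: (invmx A *m u))) / m ^+ 2).
Proof.
have E r : \int[leb]_x (expR (r * dot u x) * p x) =
    \int[leb]_x (expR (r * dot u x) * tilt A h t x) / m.
  have it := tilt_exp_integrable h pA t0 ct tM (r *: u).
  transitivity (\int[leb]_x (expR (dot (r *: u) x) * tilt A h t x * m^-1)).
    by apply: eq_Rintegral => x _ /=; rewrite dotZl /p /normalized mulrA.
  rewrite (RintegralZr m^-1 measurableT it); congr (_ / _).
  by apply: eq_Rintegral => x _ /=; rewrite dotZl.
rewrite !E !(tilt_mgf h pA t0 ct tM) scaleNr sqrrN.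
have alg (e1 e2 a b k : R) : e1 * a / k * (e2 * b / k) = e1 * e2 * (a * b / k ^+ 2).
  by rewrite mulrACA [X in X * _]mulrACA -invfM -expr2 -mulrA.
by rewrite alg -expRD; congr (expR _ * _); field.
Qed.

(** By [mgf_prod], the product of the values at [s] and [- s] of the moment
generating function of [p] is that of a Gaussian of covariance [A^-1] times a
factor that [shifted_mass_log_concave] bounds by [1]. *)
Lemma covmx_tilt_le u : qform (covmx p) u <= qform (invmx A) u.
Proof.
apply: (qform_covmx_le mp p0 ip p1) => s; rewrite mgf_prod.
apply: ler_piMr; first exact: expR_ge0.
rewrite ler_pdivrMr; last exact: exprn_gt0.
by rewrite mul1r; exact: shifted_mass_log_concave tM _.
Qed.

Lemma covmx_tilt_ge u : (forall x, t x = 1) ->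
  qform (invmx A) u <= qform (covmx p) u.
Proof.
move=> t1; apply: (qform_covmx_ge mp p0 ip p1) => s; rewrite mgf_prod.
rewrite !shifted_mass_cst// -expr2 divff ?mulr1//.
by rewrite gt_eqF// exprn_gt0.
Qed.

End covariance_of_tilt.

(** * The update *)

Section gaussian_densities.
Context {R : realType} {n : nat}.
Local Notation leb := (@lebesgue_Rn R n).
Implicit Types (f : 'cV[R]_n -> R) (C : 'M[R]_n).

(** Expanding the form at [x - mu], the linear term has coefficient
[C^-1 mu]. *)
Lemma proportional_gauss_pdf mu C : posdefmx C ->
  proportional (gauss_pdf mu C) (gauss_weight (invmx C) (invmx C *m mu)).
Proof.
move=> pC; have [Cis _] := posdef_invmx pC.
have powR_gt0_neq0 (a r : R) : a != 0 -> 0 < a `^ r.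
  by move=> a0; rewrite /powR (negbTE a0) expR_gt0.
pose k := (2 * pi) `^ (- (n%:R / 2)) * (\det C) `^ (- (1 / 2)) : R.
have k0 : 0 < k.
  apply: mulr_gt0; apply: powR_gt0_neq0.
    by rewrite gt_eqF// mulr_gt0// pi_gt0.
  by have := posdef_unitmx pC; rewrite unitmxE unitfE.
exists (k * expR (- (1 / 2) * qform (invmx C) mu)); first by rewrite mulr_gt0 ?expR_gt0.
move=> x; rewrite /gauss_pdf /gauss_weight -/k -mulrA -expRD; congr (_ * expR _).
rewrite qformB// [dot (_ *m _) _]dotC; by field.
Qed.

Lemma prod_gauss_weight (I : finType) (P : pred I) (f : I -> 'cV[R]_n -> R)
    (A : I -> 'M[R]_n) (h : I -> 'cV[R]_n) :
  (forall i, proportional (f i) (gauss_weight (A i) (h i))) ->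
  proportional (fun x => \prod_(i | P i) f i x)
    (gauss_weight (\sum_(i | P i) A i) (\sum_(i | P i) h i)).
Proof.
move=> fA.
have /choice[c cE] : forall i, exists c : R, 0 < c /\
    forall x, f i x = c * gauss_weight (A i) (h i) x.
  by move=> i; have [c c0 cE] := fA i; exists c.
exists (\prod_(i | P i) c i); first by apply: prodr_gt0 => i _; exact: (cE i).1.
move=> x; under eq_bigr do rewrite (cE _).2.
rewrite big_split/=; congr (_ * _).
by rewrite /gauss_weight -expR_sum big_split/= -mulr_sumr qform_suml dot_suml.
Qed.

Lemma normalizable_scale (c : R) f : 0 < c -> normalizable f ->
  normalizable (fun x => c * f x).
Proof.
move=> c0 [If mf]; split; first by have := integrableZl measurableT c If.
by rewrite /mass RintegralZl// mulr_gt0.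
Qed.

Lemma normalized_scale (c : R) f : 0 < c -> normalizable f ->
  normalized (fun x => c * f x) = normalized f.
Proof.
move=> c0 [If mf]; apply/funext => x; rewrite /normalized /mass RintegralZl//.
by rewrite -/(mass f); field; rewrite !gt_eqF.
Qed.

Lemma log_concave_cst1 : log_concave (fun _ : 'cV[R]_n => 1 : R).
Proof. by move=> x y l _; rewrite !powR1 mulr1. Qed.

(** The case [t = 1] of a perturbed Gaussian, where both comparisons of variances
hold. *)
Lemma covmx_gauss_weight (A : 'M[R]_n) (h : 'cV[R]_n) : posdefmx A ->
  [/\ normalizable (gauss_weight A h),
      has_second_moments (normalized (gauss_weight A h)) &
      covmx (normalized (gauss_weight A h)) = invmx A].
Proof.
move=> pA; pose t1 := fun _ : 'cV[R]_n => 1 : R.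
have t10 x : 0 <= t1 x by rewrite ler01.
have t1M x : t1 x <= 1 by [].
have ct1 := log_concave_cst1.
have ts1 : (0 < leb [set x | (t1 x != 0)%R])%E.
  rewrite (_ : [set x | _] = setT); last by apply/seteqP; split => x //= _; exact: oner_neq0.
  have := @lebesgue_Rn_box R n 0 (const_mx 1).
  set B := (X in lebesgue_Rn n X) => hB.
  apply: (@lt_le_trans _ _ (lebesgue_Rn n B)); last exact: le_mu_ext.
  rewrite hB => [|i]; last by rewrite !mxE.
  by rewrite lte_fin prodr_gt0// => i _; rewrite !mxE subr0.
have E : gauss_weight A h = tilt A h t1 by apply/funext => x; rewrite /tilt mul1r.
rewrite E; have nt := normalizable_tilt h pA t10 ct1 t1M ts1.
have [_ mt] := nt; split => //.
  exact: (tilt_second_moments pA t10 ct1 t1M mt).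
have [sc _] := posdef_covmx_tilt pA t10 ct1 t1M mt.
have [si _] := posdef_invmx pA.
apply: sym_qform_inj => // u; apply/le_anti/andP; split.
  exact: (covmx_tilt_le pA t10 ct1 t1M mt).
exact: (covmx_tilt_ge pA t10 ct1 t1M mt).
Qed.

End gaussian_densities.

Theorem theorem2p2 (R : realType) (n : nat) (I : finType)
  (cardI : (1 < #|I|)%N)
  (t : I -> 'cV[R]_n -> R)
  (t_ge0 : forall i x, 0 <= t i x)
  (t_log_concave : forall i, log_concave (t i))
  (t_bounded : exists M : R, forall i x, t i x <= M)
  (t_support : forall i, (0 < lebesgue_Rn n [set x | (t i x != 0)%R])%E)
  (mu : I -> 'cV[R]_n) (C : I -> 'M[R]_n)
  (C_posdef : forall i, posdefmx (C i))
  (tapp : I -> 'cV[R]_n -> R)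
  (tapp_gaussian : forall i, proportional (tapp i) (gauss_pdf (mu i) (C i))) :
  forall i : I,
    let q_cav := normalized (cavity tapp i) in
    let q := normalized (tilted t tapp i) in
    let K := invmx (covmx q) - invmx (covmx q_cav) in
    [/\ normalizable (cavity tapp i) /\ has_second_moments q_cav,
        normalizable (tilted t tapp i) /\ has_second_moments q,
        covmx q_cav \in unitmx /\ covmx q \in unitmx,
        has_inverse_covariance (ep_update t tapp i) K
      & possemidefmx K].
Proof.
move=> i q_cav q K.
have [M tM] := t_bounded.
pose A := \sum_(j | j != i) invmx (C j).
pose h := \sum_(j | j != i) invmx (C j) *m mu j.
have pA : posdefmx A.
  apply: posdef_sum => [|j _]; last exact: posdef_invmx.
  have /card_gt1P[j1 [j2 [_ _ j12]]] := cardI.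
  have [j1i|] := eqVneq j1 i; last by exists j1.
  by exists j2; rewrite -j1i eq_sym.
have [c c0 cE] : proportional (cavity tapp i) (gauss_weight A h).
  apply: prod_gauss_weight => j.
  have [a a0 aE] := tapp_gaussian j.
  have [b b0 bE] := proportional_gauss_pdf (mu j) (C_posdef j).
  exists (a * b); first by rewrite mulr_gt0.
  by move=> x; rewrite aE bE mulrA.
have [nG mG covG] := covmx_gauss_weight h pA.
have ntilt := normalizable_tilt h pA (t_ge0 i) (t_log_concave i) (tM i) (t_support i).
have [_ mtilt] := ntilt.
have q_cavE : q_cav = normalized (gauss_weight A h).
  by rewrite /q_cav (funext cE) normalized_scale.
have tiltE : tilted t tapp i = fun x => c * tilt A h (t i) x.
  by apply/funext => x; rewrite /tilted cE /tilt mulrCA.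
have qE : q = normalized (tilt A h (t i)) by rewrite /q tiltE normalized_scale.
have pq : posdefmx (covmx q).
  by rewrite qE; exact: (posdef_covmx_tilt pA (t_ge0 i) (t_log_concave i) (tM i) mtilt).
have pcav : covmx q_cav = invmx A by rewrite q_cavE.
have KE : K = invmx (covmx q) - A by rewrite /K pcav invmxK.
have [As _] := pA; have pqi := posdef_invmx pq; have [qs _] := pqi.
have Ks : K^T = K by rewrite KE linearB/= qs As.
split.
- split; last by rewrite q_cavE.
  by rewrite (funext cE); exact: normalizable_scale.
- split; first by rewrite tiltE; exact: normalizable_scale.
  by rewrite qE; exact: (tilt_second_moments pA (t_ge0 i) (t_log_concave i) (tM i) mtilt).
- split; last exact: posdef_unitmx.
  by rewrite pcav unitmx_inv; exact: posdef_unitmx.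
- split => //.
  have [b b0 bE] := proportional_gauss_pdf (mean q) pq.
  exists (invmx (covmx q) *m mean q - h), (b / c); first by rewrite divr_gt0.
  move=> x; rewrite /ep_update /ep_projection -/q bE cE /gauss_weight.
  rewrite -/(dot _ x) KE qform_subl dotDl dotNl.
  rewrite invfM mulrACA -expRN -expRD; congr (_ * expR _).
  ring.
split => // x; rewrite KE qform_subl subr_ge0.
have := posdef_invmx_anti pq (posdef_invmx pA).
rewrite invmxK; apply => u; rewrite qE.
exact: (covmx_tilt_le pA (t_ge0 i) (t_log_concave i) (tM i) mtilt).
Qed.
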